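(* Let $(G,S)$ be a right-angled Artin group. The mapping $w\in G\mapsto \mathrm{Prim}(w)$ induces an antiisomorphism of the ordered set of the quasidirections $\bullet_w$, $w\in G$, onto the set $\mathcal F(G)$, ordered by inclusion, consisting of the finite subsets $F\subseteq\mathrm{Prim}(G)$ satisfying (i) $X_p\cap X_q\neq\emptyset$ for $p,q\in F$, and (ii) $a^{-1}pa\perp a^{-1}qa$ for $p,q\in F$, $p\neq q$, and for some (equivalently, for all) $a\in X_p\cap X_q$. That is, $\bullet_w\mapsto\mathrm{Prim}(w)$ is a well-defined bijection of $\{\bullet_w: w\in G\}$ onto $\mathcal F(G)$, and $\bullet_w\le\bullet_u\iff\mathrm{Prim}(u)\subseteq\mathrm{Prim}(w)$ for $u,w\in G$.
   Context: $(G,S)$ is a right-angled Artin group: $S\subseteq G$ is a (possibly infinite) generating set of the group $G$ with $S\cap S^{-1}=\emptyset$, and $G$ has the presentation $\langle S\,;\,[s,t]=1$ for those $s\neq t$ in $S$ with $st=ts$ in $G\rangle$. Let $l$ be the word length on $G$ with respect to $S\cup S^{-1}$. Write $x\subset y$ iff $l(x)+l(x^{-1}y)=l(y)$; this is a partial order with least element $1$, in which any two elements have a greatest lower bound $x\cap y$. Elements $x,y$ are orthogonal, $x\perp y$, if $x\cap y=1$ and $x,y$ have a least upper bound for $\subset$ (equivalently, a common upper bound). Put $[x,y]=\{z\in G: x^{-1}z\subset x^{-1}y\}$ and $Y(x,y,z)=x(x^{-1}y\cap x^{-1}z)$, the unique element of $[x,y]\cap[y,z]\cap[z,x]$. A subset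 $I$ is convex if $[x,y]\subseteq I$ for all $x,y\in I$; the convex closure of a set is the smallest convex set containing it. An element $w$ is cyclically reduced if $w\cap w^{-1}=1$. For $w\in G$ put $\varphi_w(x)=Y(wx,x,w^{-1}x)$ and $X_w=\varphi_w(G)=\{x\in G: x^{-1}wx \text{ is cyclically reduced}\}$. For a cyclically reduced $v$ let $X_{v,1}$ be the convex closure of $\{v^n:n\in\mathbb Z\}$ and $H_v=Z_G(v)\cap X_{v,1}$. An element $w\neq1$ is primitive if for some (equivalently, for all) $a\in X_w$ the group $H_{a^{-1}wa}$ is cyclic, generated by $a^{-1}wa$; $\mathrm{Prim}(G)$ is the set of primitive elements. Every $w\in G$ can be written, uniquely up to order of the factors, as $w=\prod_{i=1}^n p_i^{m_i}$ with $p_i$ primitive, $m_i\ge1$, and $a^{-1}p_ia\perp a^{-1}p_ja$ for all $i\neq j$ and all $a\in X_w$; $\mathrm{Prim}(w)=\{p_1,\dots,p_n\}$ (so $\mathrm{Prim}(1)=\emptyset$). For $w\in G$ let $\preceq_w$ be the preorder $x\preceq_wy\iff y\in[x,wy]$. For $x,y\in G$ the set $U_{x,y}=\{z\in[x,y]:x\preceq_wz,\ y\preceq_wz\}$ is nonempty and convex, and $x\bullet_wy$ denotes its element nearest to $x$, i.e. the unique $c\in U_{x,y}$ with $c\in[x,z]$ for all $z\in U_{x,y}$. This operation $\bullet_w$ is called the quasidirection determined by $w$; one has $x\preceq_wy\iff y\bullet_wx=y$. Quasidirections are ordered by: $\bullet_w\le\bullet_u$ iff $x\preceq_wy$ implies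 $x\preceq_uy$ for all $x,y\in G$. *)

(* Defs.v *)
From mathcomp Require Import all_boot.
From mathcomp Require Import all_classical.

Set Implicit Arguments.
Unset Strict Implicit.
Unset Printing Implicit Defensive.

Local Open Scope classical_set_scope.
Local Open Scope group_scope.

(* Group words: the letter (s, false) stands for s and (s, true) for its formal
   inverse. *)
Definition word (G : groupType) := seq (G * bool).

Definition word_over (G : groupType) (S : set G) (w : word G) : Prop :=
  forall a, a \in w -> S a.1.

Definition word_val (G : groupType) (w : word G) : G :=
  \prod_(a <- w) (if a.2 then a.1^-1 else a.1).

(* The congruence on words over S whose quotient is the group presented by the
   generators S and the relators R: it is generated by free cancellation and by
   r = 1 for r in R. *)
Inductive pres_eq (G : groupType) (S : set G) (R : set (word G)) :
    word G -> word G -> Prop :=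
| pres_refl u : pres_eq S R u u
| pres_sym u v : pres_eq S R u v -> pres_eq S R v u
| pres_trans u v w : pres_eq S R u v -> pres_eq S R v w -> pres_eq S R u w
| pres_cancel u v s b :
    S s -> pres_eq S R (u ++ [:: (s, b); (s, ~~ b)] ++ v) (u ++ v)
| pres_relator u v r : R r -> pres_eq S R (u ++ r ++ v) (u ++ v).

Definition generates (G : groupType) (S : set G) : Prop :=
  forall g : G, exists2 w, word_over S w & word_val w = g.

Definition has_presentation (G : groupType) (S : set G) (R : set (word G)) :
    Prop :=
  generates S /\
  forall u v, word_over S u -> word_over S v ->
    (word_val u = word_val v <-> pres_eq S R u v).

Definition raag_relators (G : groupType) (S : set G) : set (word G) :=
  [set r | exists s t, [/\ S s, S t, s <> t, s * t = t * s
     & r = [:: (s, true); (t, true); (s, false); (t, false)]]].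

Definition is_raag (G : groupType) (S : set G) : Prop :=
  S `&` [set s^-1 | s in S] = set0 /\ has_presentation S (raag_relators S).

(* The value of xget below is the intended one whenever S generates G; the
   default 0 is then never used. *)
Definition wlen (G : groupType) (S : set G) (g : G) : nat :=
  xget 0%N [set n | (exists w, [/\ word_over S w, word_val w = g & size w = n])
    /\ forall w, word_over S w -> word_val w = g -> (n <= size w)%N].

Definition pre (G : groupType) (S : set G) (x y : G) : Prop :=
  (wlen S x + wlen S (x^-1 * y))%N = wlen S y.

Definition is_glb (G : groupType) (S : set G) (x y z : G) : Prop :=
  [/\ pre S z x, pre S z y & forall t, pre S t x -> pre S t y -> pre S t z].

Definition is_lub (G : groupType) (S : set G) (x y z : G) : Prop :=
  [/\ pre S x z, pre S y z & forall t, pre S x t -> pre S y t -> pre S z t].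

(* In a right-angled Artin group greatest lower bounds exist and are unique, so
   that the default 1 is never used. *)
Definition meet (G : groupType) (S : set G) (x y : G) : G :=
  xget 1 [set z | is_glb S x y z].

Definition orthogonal (G : groupType) (S : set G) (x y : G) : Prop :=
  meet S x y = 1 /\ exists z, is_lub S x y z.

Definition segment (G : groupType) (S : set G) (x y : G) : set G :=
  [set z | pre S (x^-1 * z) (x^-1 * y)].

Definition median (G : groupType) (S : set G) (x y z : G) : G :=
  x * meet S (x^-1 * y) (x^-1 * z).

Definition convex (G : groupType) (S : set G) (I : set G) : Prop :=
  forall x y, I x -> I y -> segment S x y `<=` I.

Definition convex_closure (G : groupType) (S : set G) (A : set G) : set G :=
  smallest (convex S) A.

Definition cyclically_reduced (G : groupType) (S : set G) (w : G) : Prop :=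
  meet S w w^-1 = 1.

Definition phi (G : groupType) (S : set G) (w x : G) : G :=
  median S (w * x) x (w^-1 * x).

Definition X_ (G : groupType) (S : set G) (w : G) : set G := range (phi S w).

(* { v ^ n | n in Z } *)
Definition zpowers (G : groupType) (v : G) : set G :=
  [set g | exists n : nat, g = v ^+ n \/ g = v ^- n].

Definition H_ (G : groupType) (S : set G) (v : G) : set G :=
  [set g | commute g v] `&` convex_closure S (zpowers v).

(* p ^ a is the conjugate a^-1 * p * a. *)
Definition primitive (G : groupType) (S : set G) (w : G) : Prop :=
  w <> 1 /\ exists2 a, X_ S w a & H_ S (w ^ a) = zpowers (w ^ a).

Definition prim_decomp (G : groupType) (S : set G) (w : G)
    (n : nat) (p : 'I_n -> G) (m : 'I_n -> nat) : Prop :=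
  [/\ w = \prod_(i < n) p i ^+ m i,
      forall i, primitive S (p i),
      forall i, (1 <= m i)%N
    & forall i j a, i <> j -> X_ S w a -> orthogonal S (p i ^ a) (p j ^ a)].

(* The set of factors of the decomposition of w, which is unique up to the
   order of the factors. *)
Definition Prim (G : groupType) (S : set G) (w : G) : set G :=
  [set q | exists n (p : 'I_n -> G) (m : 'I_n -> nat),
     prim_decomp S w p m /\ range p q].

Definition qprec (G : groupType) (S : set G) (w x y : G) : Prop :=
  segment S x (w * y) y.

Definition U_ (G : groupType) (S : set G) (w x y : G) : set G :=
  [set z | [/\ segment S x y z, qprec S w x z & qprec S w y z]].

(* The gate of x in U_ S w x y, which exists and is unique, so that the default
   1 is never used. *)
Definition quasidir (G : groupType) (S : set G) (w : G) : G -> G -> G :=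
  fun x y => xget 1 [set c | U_ S w x y c /\
                             forall z, U_ S w x y z -> segment S x z c].

(* The order on quasidirections, stated through determining elements; it only
   depends on the operations, as qprec S w x y iff quasidir S w y x = y. *)
Definition quasidir_le (G : groupType) (S : set G) (w u : G) : Prop :=
  forall x y, qprec S w x y -> qprec S u x y.

Definition orth_prim_sets (G : groupType) (S : set G) : set (set G) :=
  [set F | [/\ finite_set F,
      F `<=` primitive S,
      forall p q, F p -> F q -> X_ S p `&` X_ S q !=set0
    & forall p q, F p -> F q -> p <> q ->
        exists2 a, (X_ S p `&` X_ S q) a & orthogonal S (p ^ a) (q ^ a)]].

(* Main.v *)
(* Proof idea. Since y lies in [x, wy] iff y^-1 x and y^-1 w y have no first
   letter in common, the preorder of w is determined by the sets D_w(y) of first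
   letters of the conjugates y^-1 w y, and the quasidirection of w is at most
   that of u iff D_u(y) is contained in D_w(y) for all y. If w is the product of
   powers of the orthogonal primitive elements p_i, then D_w(y) is the union of
   the D_{p_i}(y), so an inclusion of the sets of primitive factors gives a
   comparison of quasidirections. Conversely, let q be primitive with
   D_q(y) contained in D_w(y) for all y. Moving along an axis of q conjugates w
   by first letters of w, which never increases its length; by finiteness some
   power of q, hence q itself, commutes with w. At a point where both are
   cyclically reduced, q is then a prefix of a power of w; being indecomposable
   it is a prefix of a power of a single p_i, which it commutes with, and
   comparing letter counts gives q = p_i. This also shows that the decomposition
   is unique. A set in F(G) consists of commuting elements, so its members are
   cyclically reduced at a common point and their product realizes it. *)

Require Import Defs.
From mathcomp Require Import all_boot zify.
From mathcomp Require Import all_classical.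

Set Implicit Arguments.
Unset Strict Implicit.
Unset Printing Implicit Defensive.

Local Open Scope classical_set_scope.
Local Open Scope group_scope.

(** * Pilings: a faithful action on stacks that solves the word problem *)

(** The presentation alone does not show that letters and first letters of an element are well
    defined. The action on stacks does: relators act trivially, and a word read without cancellation
    is recovered from its stacks up to the order of its letters. Meets, segments, orthogonality and
    the sets [X_] are then restated through first letters. Two obstacles shape the comparison.
    Equality of the operations says nothing at the point 1, the default value of [quasidir], so
    first letters are compared only away from 1, and every walk along an axis starts far out. And
    [S] may be infinite, so bounded length does not leave finitely many elements; but once the
    lengths along the axis are constant, so are the sets of letters. The formula for the first
    letters of a product of orthogonal factors is needed at all points, not only where the product
    is cyclically reduced. For this a conjugating element is split into a part that a factor absorbs
    and a part that lengthens it. *)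

Section Pilings.
Variable G : groupType.
Implicit Types (s t : G) (a b c : G * bool) (u v w : word G).

(* The stack of a generator [s] holds [Some b] for each letter [(s, b)] and a
   placeholder [None] for each letter that does not commute with [s]. *)
Definition piling := G -> seq (option bool).
Implicit Types f : piling.

Definition linv a : G * bool := (a.1, ~~ a.2).

Lemma linvK : involutive linv.
Proof. by case=> s b; rewrite /linv /= negbK. Qed.

Definition depends s t := s * t != t * s.

Definition push a f : piling := fun t =>
  if t == a.1 then Some a.2 :: f t
  else if depends a.1 t then None :: f t else f t.

Definition pop s f : piling := fun t =>
  if (t == s) || depends s t then behead (f t) else f t.

(** One stack is enough to see that [a] can be moved to the front: any obstructing letter would
    cover it there, by a placeholder or by a letter of the same generator. *)
Definition top a f := ohead (f a.1) == Some (Some a.2).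

Definition act a f := if top (linv a) f then pop a.1 f else push a f.

Definition pile w : piling := foldr act (fun=> [::]) w.

Fixpoint piled w := if w is a :: w' then ~~ top (linv a) (pile w') && piled w' else true.

Lemma dependsC s t : depends s t = depends t s.
Proof. by rewrite /depends eq_sym. Qed.

Lemma pushK a f : pop a.1 (push a f) = f.
Proof.
apply: funext => t; rewrite /pop /push.
by case: eqP => //= _; case: ifP => //= ->.
Qed.

Lemma push_inj a : injective (push a).
Proof. by move=> f g e; rewrite -(pushK a f) e pushK. Qed.

Lemma top_push a f : top a (push a f).
Proof. by rewrite /top /push eqxx. Qed.

Lemma push_comm a b f : a.1 != b.1 -> ~~ depends a.1 b.1 ->
  push a (push b f) = push b (push a f).
Proof.
move=> nab dab; apply: funext => t; rewrite /push.
case: (eqVneq t a.1) => [->|na]; last first.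
  by case: (eqVneq t b.1) => [->|nb]; rewrite ?(negbTE dab) //; do 2!case: ifP.
by rewrite (negbTE nab) dependsC (negbTE dab).
Qed.

Lemma top_pushN a b f : a.1 != b.1 -> ~~ depends b.1 a.1 ->
  top a (push b f) = top a f.
Proof. by move=> nab dab; rewrite /top /push (negbTE nab) (negbTE dab). Qed.

Lemma top_push_indep a b f : a != b -> top a (push b f) ->
  (a.1 != b.1) && ~~ depends b.1 a.1.
Proof.
case: a b => [s x] [t y]; rewrite /top /push /= xpair_eqE.
case: eqVneq => /= [_ nxy /eqP[exy]|nst _]; first by rewrite exy eqxx in nxy.
by case: ifP.
Qed.

Lemma pile_cons a w : piled (a :: w) -> pile (a :: w) = push a (pile w).
Proof. by rewrite /= /act => /andP[/negbTE->]. Qed.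

(** A letter on top of its stack can be shuffled to the front, since a letter ahead of it that does
    not commute with it would cover its stack. *)
Lemma piled_top w a : piled w -> top a (pile w) ->
  exists w', [/\ piled (a :: w'), perm_eq w (a :: w'), pile w = pile (a :: w')
    & word_val w = word_val (a :: w')].
Proof.
elim: w => [|b w IHw] //= /andP[nb pw].
rewrite /act (negbTE nb); case: (eqVneq a b) => [-> _|nab ta].
  by exists w; rewrite /= /act (negbTE nb) pw.
have /andP[nab1 dab] := top_push_indep nab ta.
rewrite top_pushN // in ta.
have [w' [/= /andP[na pw'] e1 e2 e3]] := IHw pw ta.
have epw : pile w = push a (pile w') by rewrite e2 /act (negbTE na).
have nb' : ~~ top (linv b) (pile w').
  by rewrite epw top_pushN // 1?eq_sym // dependsC in nb.
have pb : piled (b :: w') by rewrite /= nb'.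
have pab : piled [:: a, b & w'].
  by apply/andP; split=> //; rewrite (pile_cons pb) top_pushN // 1?dependsC.
exists (b :: w'); split => //.
- have := perm_cons b w (a :: w'); rewrite e1 => /perm_trans->//.
  by rewrite (perm_catCA [:: b] [:: a] w').
- rewrite -[RHS]/(pile [:: a, b & w']) (pile_cons pab) (pile_cons pb) epw.
  by rewrite push_comm // eq_sym.
- rewrite /word_val !big_cons in e3 *; rewrite e3 !mulgA; congr (_ * _).
  have : commute b.1 a.1 by apply/eqP; move: dab; rewrite /depends negbK.
  case: (b.2) (a.2) => [] [] h //=.
  + by apply/commute_sym/commuteV/commute_sym/commuteV.
  + by apply/commute_sym/commuteV/commute_sym.
  + exact/commuteV.
Qed.

(** A letter whose inverse is on top cancels against it once that inverse has been moved to the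
    front. The bounds on size and letters make piled words the shortest words over [S]. *)
Lemma piled_reduce w : exists w', [/\ piled w', pile w = pile w',
  word_val w = word_val w', (size w' <= size w)%N & {subset w' <= w}].
Proof.
elim: w => [|a w [w1 [p1 e1 v1 s1 m1]]]; first by exists [::].
have [ta|nta] := boolP (top (linv a) (pile w1)); last first.
  exists (a :: w1); split => //=; rewrite ?p1 ?nta ?e1 //.
    by rewrite /word_val !big_cons; congr (_ * _).
  by move=> b; rewrite !inE => /orP[->//|/m1->]; rewrite orbT.
have [w2 [p2 e2 e3 v2]] := piled_top p1 ta.
exists w2; split.
- by case/andP: p2.
- by rewrite [LHS]/= /act e1 ta e3 (pile_cons p2) (pushK (linv a)).
- rewrite /word_val big_cons -/(word_val w) v1 v2 /word_val big_cons /=.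
  by case: (a.2); rewrite /= ?mulKg ?mulVKg.
- by rewrite (perm_size e2) /= in s1; rewrite /=; lia.
- move=> b wb; rewrite inE (m1 b) ?orbT // (perm_mem e2) inE wb orbT //.
Qed.

Lemma act_push a f : ~~ top (linv a) f -> act a f = push a f.
Proof. by rewrite /act => /negbTE->. Qed.

Lemma act_pop a f : act a (push (linv a) f) = f.
Proof. by rewrite /act top_push (pushK (linv a)). Qed.

Lemma top_pile a w : top a (pile w) ->
  exists2 w', pile w = push a (pile w') & ~~ top (linv a) (pile w').
Proof.
have [w1 [p1 -> _ _ _]] := piled_reduce w => ta.
have [w2 [p2 _ -> _]] := piled_top p1 ta.
by exists w2; [exact: pile_cons|case/andP: p2].
Qed.

(** Stated only for stacks that come from words: in an arbitrary family a letter may be on top of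
    its stack without matching placeholders on the others, and then [pop] cannot be undone. *)
Lemma actK a w : act (linv a) (act a (pile w)) = pile w.
Proof.
have [ta|nta] := boolP (top (linv a) (pile w)); last first.
  by rewrite (act_push nta) -{2}(linvK a) act_pop.
by have [w1 -> n1] := top_pile ta; rewrite act_pop act_push.
Qed.

Lemma act_comm_notop a b w : a.1 != b.1 -> ~~ depends a.1 b.1 ->
  ~~ top (linv b) (pile w) -> act a (act b (pile w)) = act b (act a (pile w)).
Proof.
move=> nab dab nb; have nba : b.1 != a.1 by rewrite eq_sym.
have dba : ~~ depends b.1 a.1 by rewrite dependsC.
rewrite (act_push nb); have [ta|na] := boolP (top (linv a) (pile w)); last first.
  by rewrite !act_push ?top_pushN // push_comm.
have [w1 e1 n1] := top_pile ta; rewrite e1 in nb *.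
rewrite top_pushN // in nb.
by rewrite act_pop (act_push nb) (@push_comm b (linv a)) // act_pop.
Qed.

Lemma act_comm a b w : a.1 != b.1 -> ~~ depends a.1 b.1 ->
  act a (act b (pile w)) = act b (act a (pile w)).
Proof.
move=> nab dab; have nba : b.1 != a.1 by rewrite eq_sym.
have dba : ~~ depends b.1 a.1 by rewrite dependsC.
have [tb|nb] := boolP (top (linv b) (pile w)); last exact: act_comm_notop.
have [ta|na] := boolP (top (linv a) (pile w)); last by rewrite (@act_comm_notop b a).
have [w1 e1 _] := top_pile ta; rewrite e1 top_pushN // in tb.
have [w2 e2 _] := top_pile tb.
by rewrite e1 act_pop e2 (@push_comm (linv a)) // !act_pop.
Qed.

Lemma pile_cat u v : pile (u ++ v) = foldr act (pile v) u.
Proof. exact: foldr_cat. Qed.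

Lemma pile_catr u v w : pile v = pile w -> pile (u ++ v) = pile (u ++ w).
Proof. by rewrite !pile_cat => ->. Qed.

Lemma pile_pres_eq (S : set G) u v :
  pres_eq S (raag_relators S) u v -> pile u = pile v.
Proof.
elim=> [//|u1 v1 _ ->//|u1 v1 w1 _ -> _ ->//|u1 v1 s b Ss|u1 v1 r].
  apply: pile_catr => /=.
  by rewrite -{2}(actK (s, ~~ b) v1) /linv /= negbK.
case=> s [t [Ss St /eqP nst cst ->]]; apply: pile_catr => /=.
have cst' : ~~ depends s t by rewrite /depends cst eqxx.
rewrite -[act (t, false) (pile v1)]/(pile ((t, false) :: v1)).
have e : act (s, false) (act (t, false) (pile v1)) =
    act (t, false) (act (s, false) (pile v1)) by apply: act_comm.
rewrite e -[act (s, false) (pile v1)]/(pile ((s, false) :: v1)).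
by rewrite (actK (t, false)) (actK (s, false)).
Qed.

(** The first letter of [u] is on top of the common stacks, so it can be brought to the front of [v]
    and removed from both. *)
Lemma piled_perm u v : piled u -> piled v -> pile u = pile v -> perm_eq u v.
Proof.
elim: u v => [|a u IHu] v pu pv e.
  case: v pv e => [//|b v] pv.
  rewrite (pile_cons pv) => /(congr1 (fun f => top b f)).
  by rewrite top_push.
have ta : top a (pile v) by rewrite -e (pile_cons pu) top_push.
have [v' [pv' e1 e2 _]] := piled_top pv ta.
rewrite e2 (pile_cons pu) (pile_cons pv') in e.
rewrite perm_sym (perm_trans e1) // perm_cons perm_sym.
by apply: IHu; [case/andP: pu|case/andP: pv'|apply: push_inj e].
Qed.

End Pilings.
(** * Word length and first letters *)

Section RightAngledArtinGroup.
Variables (G : groupType) (S : set G).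
Hypothesis hGS : is_raag S.
Implicit Types (a b c d e g h k p q r u v w x y z : G).
Local Notation l := (wlen S).

Definition letter c : bool := `[< S c \/ S c^-1 >].

Definition init c g : bool := letter c && (l (c^-1 * g) < l g)%N.

(** Equal and inverse letters commute as well; excluding them leaves the commuting pairs of
    different generators. *)
Definition indep c d : bool := [&& c * d == d * c, c != d & c != d^-1].

Definition lval (a : G * bool) : G := if a.2 then a.1^-1 else a.1.

(** Only the multiset of its letters is canonical, by [rword_perm]; [cnt], [perp] and [orthl] depend
    on nothing else. *)
Definition rword g : word G :=
  xget [::] [set w : word G | [/\ piled w, word_over S w & word_val w = g]].

Definition cnt c g : nat := count (fun a : G * bool => lval a == c) (rword g).

Lemma word_val_cons (a : G * bool) (w : word G) : word_val (a :: w) = lval a * word_val w.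
Proof. by rewrite /word_val big_cons. Qed.

Lemma lval_linv (a : G * bool) : lval (linv a) = (lval a)^-1.
Proof. by case: a => s [] /=; rewrite /lval /= ?invgK. Qed.

Lemma letterP c : reflect (exists2 a : G * bool, S a.1 & lval a = c) (letter c).
Proof.
apply: (iffP (asboolP _)) => [[Sc|Sc]|[[s []] /= Ss <-]]; rewrite /lval /=.
- by exists (c, false).
- by exists (c^-1, true); rewrite /= ?invgK.
- by right; rewrite invgK.
- by left.
Qed.

Lemma letterV c : letter c^-1 = letter c.
Proof.
by apply/asboolP/asboolP; rewrite ?invgK => -[]; by [left|right].
Qed.

Lemma letter_init c g : init c g -> letter c. Proof. by case/andP. Qed.

Lemma S_invN s : S s -> S s^-1 -> False.
Proof.
case: hGS => e _ Ss Ss'; suff : set0 s by []; rewrite -e; split=> //.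
by exists s^-1; rewrite ?invgK.
Qed.

Lemma lval_inj (a b : G * bool) : S a.1 -> S b.1 -> lval a = lval b -> a = b.
Proof.
case: a b => s [] [t []] /= Ss St; rewrite /lval /=.
- by move=> /invg_inj->.
- by move=> e; move: St; rewrite -e => /(S_invN Ss).
- by move=> e; move: Ss; rewrite e => /(S_invN St).
- by move=> ->.
Qed.

Lemma rwordP g : [/\ piled (rword g), word_over S (rword g) & word_val (rword g) = g].
Proof.
case: hGS => _ [/(_ g)[w Sw vw] _].
have [w' [p' _ v' _ m']] := piled_reduce w.
apply: (@xgetPex _ [::] [set w : word G | [/\ piled w, word_over S w & word_val w = g]]).
by exists w'; split => //; [move=> a /m'; exact: Sw|rewrite -v'].
Qed.

Lemma pile_val (u v : word G) : word_over S u -> word_over S v -> word_val u = word_val v ->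
  pile u = pile v.
Proof. by case: hGS => _ [_ h] Su Sv /h-/(_ Su Sv)/pile_pres_eq. Qed.

Lemma rword_perm (w : word G) : piled w -> word_over S w -> perm_eq w (rword (word_val w)).
Proof.
move=> pw Sw; have [p r v] := rwordP (word_val w).
by apply: piled_perm => //; apply: pile_val.
Qed.

Lemma wlenE g : l g = size (rword g).
Proof.
have [p r v] := rwordP g.
pose A := [set n | (exists w : word G, [/\ word_over S w, word_val w = g & size w = n])
    /\ forall w : word G, word_over S w -> word_val w = g -> (n <= size w)%N].
suff Ag : A (size (rword g)).
  rewrite /wlen -/A; apply: xget_subset1 => // m n [[w [? ? sw]] hm] [[w' [? ? sw']] hn].
  by apply/eqP; rewrite eqn_leq -{1}sw' -{2}sw hm // hn.
split; first by exists (rword g).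
move=> w Sw vw; have [w' [p' _ v' s' m']] := piled_reduce w.
have Sw' : word_over S w' by move=> a /m'; exact: Sw.
by rewrite -vw v' -(perm_size (rword_perm p' Sw')).
Qed.

Lemma wlen_piled (w : word G) : piled w -> word_over S w -> l (word_val w) = size w.
Proof. by move=> pw Sw; rewrite wlenE -(perm_size (rword_perm pw Sw)). Qed.

Lemma cnt_piled (w : word G) c : piled w -> word_over S w ->
  cnt c (word_val w) = count (fun a : G * bool => lval a == c) w.
Proof. by move=> pw Sw; rewrite /cnt; apply/esym/permP/rword_perm. Qed.

Lemma word_over_cons (a : G * bool) (w : word G) : S a.1 -> word_over S w -> word_over S (a :: w).
Proof. by move=> Sa Sw b; rewrite inE => /predU1P[->|/Sw]. Qed.

Lemma initP (a : G * bool) g : S a.1 -> init (lval a) g <-> top a (pile (rword g)).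
Proof.
move=> Sa; have la : letter (lval a) by apply/letterP; exists a.
have [p r v] := rwordP g.
split=> [/andP[_]|ta].
  apply: contraLR => nta; rewrite -leqNgt.
  have p1 : piled (linv a :: rword g) by rewrite /= linvK nta.
  have S1 : word_over S (linv a :: rword g) by apply: word_over_cons.
  by have := wlen_piled p1 S1; rewrite word_val_cons v lval_linv => -> /=; rewrite wlenE.
have [w [p1 e1 _ v1]] := piled_top p ta.
have Sw : word_over S w by move=> b bw; apply: r; rewrite (perm_mem e1) inE bw orbT.
have pw : piled w by case/andP: p1.
rewrite /init la /=; move: v1; rewrite v word_val_cons => e.
rewrite [X in (_ * X)]e mulKg wlen_piled // wlenE (perm_size e1) /=; lia.
Qed.

Lemma cons_piled (a : G * bool) g : S a.1 -> ~~ init (lval a)^-1 g -> piled (a :: rword g).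
Proof.
move=> Sa; have [p r v] := rwordP g.
by rewrite -lval_linv => /negP ni /=; rewrite p andbT; apply/negP => /(initP _ (_ : S (linv a).1))-/(_ Sa).
Qed.

Lemma wlenM c g : letter c -> ~~ init c^-1 g -> l (c * g) = (l g).+1.
Proof.
case/letterP => a Sa <- ni; have [p r v] := rwordP g.
have := wlen_piled (cons_piled Sa ni) (word_over_cons Sa r).
by rewrite word_val_cons v /= -wlenE.
Qed.

Lemma cntM d c g : letter c -> ~~ init c^-1 g -> cnt d (c * g) = ((c == d) + cnt d g)%N.
Proof.
case/letterP => a Sa <- ni; have [p r v] := rwordP g.
have := cnt_piled d (cons_piled Sa ni) (word_over_cons Sa r).
by rewrite word_val_cons v.
Qed.

Lemma rword1 : rword 1 = [::].
Proof.
have o : word_over S [::] by [].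
have := rword_perm (isT : piled [::]) o; rewrite /word_val big_nil perm_sym => e.
exact: perm_nilP.
Qed.

Lemma wlen1 : l 1 = 0%N. Proof. by rewrite wlenE rword1. Qed.

Lemma cnt1 c : cnt c 1 = 0%N. Proof. by rewrite /cnt rword1. Qed.

Lemma wlen_eq0 g : (l g == 0)%N = (g == 1).
Proof.
apply/idP/eqP => [|->]; last by rewrite wlen1.
rewrite wlenE size_eq0 => /eqP e; have [_ _] := rwordP g.
by rewrite e /word_val big_nil.
Qed.

(** If [d] is on top after [c] has been pushed, then [c] has put neither a letter nor a placeholder
    on the stack of [d]. *)
Lemma initM c d g : letter c -> ~~ init c^-1 g -> d != c -> init d (c * g) ->
  indep c d /\ init d g.
Proof.
case/letterP => a Sa <- ni; have [p r v] := rwordP g.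
move=> + ind; have /letterP[b Sb eb] := letter_init ind; rewrite -eb => nba.
move: ind; rewrite -eb => /(initP _ Sb).
have [p' r' v'] := rwordP (lval a * g).
have Sw := word_over_cons Sa r; have pw := cons_piled Sa ni.
rewrite -(pile_val Sw r') ?word_val_cons ?v ?v' // (pile_cons pw).
have nab : b != a by apply: contraNneq nba => ->.
move=> tb; have /andP[nba1 dab] := top_push_indep nab tb.
rewrite top_pushN // in tb; split; last exact/(initP _ Sb).
move: dab; rewrite /depends negbK => /eqP dab.
have cab : commute a.1 b.1 by exact: dab.
apply/and3P; split.
- apply/eqP; rewrite /lval; case: (a.2) (b.2) => [] [] //.
  + by apply/commute_sym/commuteV/commute_sym/commuteV.
  + by apply/commute_sym/commuteV/commute_sym.
  + exact/commuteV.
- by rewrite eq_sym.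
- apply: contraNneq nba1; rewrite -lval_linv => /(lval_inj Sa (_ : S (linv b).1))-/(_ Sb) ->.
  by [].
Qed.

Lemma init_ex g : g != 1 -> exists c, init c g.
Proof.
rewrite -wlen_eq0 wlenE; have [] := rwordP g; case e : (rword g) => [//|a w] p r _ _.
have Sa : S a.1 by apply: r; rewrite inE eqxx.
by exists (lval a); apply/(initP _ Sa); rewrite e (pile_cons p) top_push.
Qed.

Lemma init1 c : init c 1 = false.
Proof. by rewrite /init wlen1 ltn0 andbF. Qed.

Lemma initK c g : init c g -> ~~ init c^-1 (c^-1 * g) /\ l g = (l (c^-1 * g)).+1.
Proof.
move=> i; have lc := letter_init i; have n : ~~ init c^-1 (c^-1 * g).
  by rewrite /init negb_and invgK mulVKg -leqNgt; case/andP: i => _ /ltnW ->; rewrite orbT.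
by split=> //; have := wlenM lc n; rewrite mulVKg.
Qed.

Lemma initV c g : letter c -> ~~ init c^-1 g -> init c (c * g).
Proof. by move=> lc n; rewrite /init lc mulKg wlenM //=. Qed.

Lemma len_ind (P : G -> Prop) : P 1 ->
  (forall c g, letter c -> ~~ init c^-1 g -> P g -> P (c * g)) -> forall g, P g.
Proof.
move=> P1 Pm g; have [n] := ubnP (l g); elim: n => // n IHn in g *.
have [->//|/init_ex[c i]] := eqVneq g 1; have [ni e] := initK i.
rewrite e ltnS => /IHn; rewrite -{2}(mulVKg c g); apply: Pm => //.
exact: letter_init i.
Qed.

Lemma wlenV g : l g^-1 = l g.
Proof.
have le h : (l h^-1 <= l h)%N.
  rewrite wlenE; have [p r v] := rwordP h.
  pose w := [seq linv a | a : G * bool <- rev (rword h)].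
  have Sw : word_over S w.
    by move=> b /mapP[a]; rewrite mem_rev => /r Sa ->.
  have vw : word_val w = h^-1.
    rewrite -v /w; elim: (rword h) => [|a u IHu]; first by rewrite /word_val !big_nil invg1.
    rewrite rev_cons map_rcons -cats1 /word_val big_cat -!/(word_val _) IHu.
    by rewrite !word_val_cons invgM lval_linv /word_val big_nil mulg1.
  have [w' [p' _ v' s' m']] := piled_reduce w.
  have Sw' : word_over S w' by move=> a /m'; exact: Sw.
  have := wlen_piled p' Sw'; rewrite -v' vw wlenE => ->.
  by rewrite (leq_trans s') // /w size_map size_rev -wlenE wlenE.
by apply/eqP; rewrite eqn_leq le -{1}(invgK g) le.
Qed.

(* Generalizes all lengths before calling lia: group products reached through
   different inheritance paths are only convertible. *)
Ltac glia :=
  repeat match goal with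
  | H : is_true (leq _ _) |- _ => revert H
  | H : @eq ?T _ _ |- _ => unify T nat; revert H
  end;
  repeat (let n := fresh "n" in set n := (wlen _ _); clearbody n);
  repeat (let n := fresh "n" in set n := (cnt _ _); clearbody n);
  clear; intros; lia.

(** * Supports, independence and products without cancellation *)

Definition supp c g : bool := (0 < cnt c g)%N.

Definition perp c x : bool := all (fun a : G * bool => indep c (lval a)) (rword x).

Definition orthl x y : bool := all (fun a : G * bool => perp (lval a) y) (rword x).

(** The diagonal case [red v v] is the working form of cyclic reducedness; see [X_P]. *)
Definition red x y : bool := l (x * y) == (l x + l y)%N.

Lemma letterVK c : letter c -> letter c^-1. Proof. by rewrite letterV. Qed.

Lemma letter_neqV c : letter c -> c != c^-1.
Proof.
move/asboolP=> lc; apply/eqP => e; case: lc => Sc.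
  by apply: (S_invN Sc); rewrite -e.
by apply: (S_invN Sc); rewrite invgK e.
Qed.

Lemma indepC c d : indep c d = indep d c.
Proof. by rewrite /indep (eq_sym (c * d)) (eq_sym c d) -eqg_invLR (eq_sym c^-1). Qed.

Lemma indepV c d : indep c d^-1 = indep c d.
Proof.
rewrite /indep invgK (andbC (c != _)); congr (_ && _).
apply/eqP/eqP => h.
  by rewrite -[d]invgK; apply/commuteV.
by apply/commuteV.
Qed.

Lemma indepVl c d : indep c^-1 d = indep c d.
Proof. by rewrite indepC indepV indepC. Qed.

Lemma indep_irr c : indep c c = false.
Proof. by rewrite /indep !eqxx. Qed.

Lemma indep_comm c d : indep c d -> c * d = d * c.
Proof. by case/and3P => /eqP. Qed.

Lemma wlen_letter c : letter c -> l c = 1%N.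
Proof. by move=> lc; have := @wlenM c 1 lc; rewrite mulg1 init1 wlen1 => ->. Qed.

Lemma cnt_letter c d : letter d -> cnt c d = (d == c).
Proof. by move=> lc; have := @cntM c d 1 lc; rewrite mulg1 init1 cnt1 addn0 => ->. Qed.

Lemma wlen_le x y : (l (x * y) <= l x + l y)%N.
Proof.
elim/len_ind: x => [|c x lc n IHx]; first by rewrite mul1g; glia.
rewrite -mulgA (wlenM lc n); have [i|ni] := boolP (init c^-1 (x * y)).
  by have [_] := initK i; rewrite invgK; glia.
by rewrite wlenM //; glia.
Qed.

Lemma indep_init c d g : letter c -> indep c d -> init d (c * g) = init d g.
Proof.
have h x e k : letter x -> indep x e -> init e (x * k) -> init e k.
  move=> lx ixe i; have [ix|nx] := boolP (init x^-1 k); last first.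
    have ne : e != x by case/and3P: ixe => _ + _; rewrite eq_sym.
    by have [] := initM lx nx ne i.
  have le := letter_init i; rewrite /init le /=; have lx' := letterVK lx.
  have [_ em] := initK ix; have [_ ei] := initK i; rewrite invgK in em.
  have -> : e^-1 * k = x^-1 * (e^-1 * (x * k)).
    by rewrite 2!mulgA (indep_comm (_ : indep x^-1 e^-1)) ?indepV ?indepVl // -!mulgA mulKg.
  have := wlen_le x^-1 (e^-1 * (x * k)); rewrite (wlen_letter lx'); glia.
move=> lc icd; apply/idP/idP; first exact: h.
by rewrite -{1}(mulKg c g) => /h; apply; rewrite ?letterV ?indepVl.
Qed.

Lemma perpP c x : reflect (forall d, supp d x -> indep c d) (perp c x).
Proof.
apply: (iffP allP) => [h d|h a ax].
  by rewrite /supp -has_count => /hasP[a ax /eqP <-]; apply: h.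
by apply: h; rewrite /supp -has_count; apply/hasP; exists a.
Qed.

Lemma orthlP x y :
  reflect (forall c d, supp c x -> supp d y -> indep c d) (orthl x y).
Proof.
apply: (iffP allP) => [h c d|h a ax].
  rewrite {1}/supp -has_count => /hasP[a ax /eqP <-] sd.
  exact: (perpP _ _ (h a ax)).
by apply/perpP => d; apply: h; rewrite /supp -has_count; apply/hasP; exists a.
Qed.

Lemma redP x y : reflect (forall c, init c x^-1 -> init c y -> False) (red x y).
Proof.
apply: (iffP eqP) => [e c ix iy|].
  have [_ e1] := initK ix; have [_ e2] := initK iy.
  have := wlen_le (c^-1 * x^-1)^-1 (c^-1 * y).
  have -> : (c^-1 * x^-1)^-1 * (c^-1 * y) = x * y.
    by rewrite invgM !invgK -mulgA mulVKg.
  by rewrite wlenV e -(wlenV x); glia.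
(* The induction runs over [x^-1], where the last letters of [x], those next to [y], come first. *)
rewrite -[l x]wlenV -{2}(invgK x); move: x^-1 => z; elim/len_ind: z y => [|c z lc n IHz] y h.
  by rewrite invg1 mul1g wlen1.
have ny : ~~ init c y by apply/negP; apply: h; apply: initV.
have lc' := letterVK lc.
rewrite invgM -mulgA IHz; first by rewrite !wlenM ?invgK //; glia.
move=> d iz id; case: (eqVneq d c^-1) => [e|ndc]; first by rewrite -e iz in n.
have [|icd iy] := initM lc' _ ndc id; first by rewrite invgK.
by apply: (h d) => //; rewrite indep_init // -indepVl.
Qed.

Lemma redV x y : red x y -> red y^-1 x^-1.
Proof. by rewrite /red -invgM !wlenV addnC. Qed.

Lemma red_consP c x : letter c -> red c x = ~~ init c^-1 x.
Proof.
move=> lc; rewrite /red (wlen_letter lc); have [i|n] := boolP (init c^-1 x).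
  by have [_] := initK i; rewrite invgK; glia.
by rewrite wlenM // add1n eqxx.
Qed.

Lemma red1 x : red x 1. Proof. by rewrite /red mulg1 wlen1 addn0. Qed.

Lemma redl x : red 1 x. Proof. by rewrite /red mul1g wlen1. Qed.

Lemma redA x y z : red x y -> red (x * y) z = red y z && red x (y * z).
Proof.
rewrite /red => /eqP e; rewrite mulgA e.
have := wlen_le y z; have := wlen_le x (y * z); rewrite mulgA => h1 h2.
by apply/eqP/andP => [h|[/eqP h /eqP h']]; [split; apply/eqP|]; glia.
Qed.

Lemma redA' x y z : red y z -> red x (y * z) = red x y && red (x * y) z.
Proof.
rewrite /red => /eqP e; rewrite mulgA e.
have := wlen_le x y; have := wlen_le (x * y) z => h1 h2.
by apply/eqP/andP => [h|[/eqP h /eqP h']]; [split; apply/eqP|]; glia.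
Qed.

Lemma red_swap x y z : x * y = y * x -> red y z -> red x (y * z) ->
  red x z /\ red y (x * z).
Proof.
move=> exy /eqP e1 /eqP; rewrite mulgA exy -mulgA e1 => e2.
have h1 := wlen_le y (x * z); have h2 := wlen_le x z.
by split; apply/eqP; glia.
Qed.

Lemma red_cons c x y : letter c -> ~~ init c^-1 x ->
  red (c * x) y = red x y && ~~ init c^-1 (x * y).
Proof. by move=> lc n; rewrite redA ?(red_consP _ lc). Qed.

Lemma cnt_red c x y : red x y -> cnt c (x * y) = (cnt c x + cnt c y)%N.
Proof.
elim/len_ind: x => [|d x ld n IHx]; first by rewrite mul1g cnt1.
rewrite red_cons // -mulgA => /andP[/IHx e n']; rewrite (cntM c ld n) (cntM c ld n') e; lia.
Qed.

Lemma supp_red c x y : red x y -> supp c (x * y) = supp c x || supp c y.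
Proof. by move=> r; rewrite /supp cnt_red // addn_gt0. Qed.

Lemma cntV c x : cnt c x^-1 = cnt c^-1 x.
Proof.
elim/len_ind: x => [|d x ld n IHx]; first by rewrite invg1 !cnt1.
have rd : red d x by rewrite red_consP.
rewrite invgM (cnt_red _ (redV rd)) (cnt_red _ rd) IHx addnC.
by rewrite (cnt_letter _ (letterVK ld)) (cnt_letter _ ld) eqg_invLR.
Qed.

Lemma suppV c x : supp c x^-1 = supp c^-1 x.
Proof. by rewrite /supp cntV. Qed.

Lemma supp_letter c d : letter d -> supp c d = (d == c).
Proof. by move=> ld; rewrite /supp cnt_letter // lt0b. Qed.

Lemma supp_cons c d x : letter c -> ~~ init c^-1 x ->
  supp d (c * x) = (c == d) || supp d x.
Proof. by move=> lc n; rewrite /supp cntM // addn_gt0 lt0b. Qed.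

Lemma supp1 c : supp c 1 = false. Proof. by rewrite /supp cnt1. Qed.

Lemma init_supp c g : init c g -> supp c g.
Proof.
move=> i; have [n _] := initK i; have lc := letter_init i.
by rewrite -(mulVKg c g) supp_cons ?eqxx.
Qed.

Lemma perp_red c x y : red x y -> perp c (x * y) = perp c x && perp c y.
Proof.
move=> r; apply/perpP/andP => [h|[/perpP hx /perpP hy] d].
  by split; apply/perpP => d sd; apply: h; rewrite supp_red // sd ?orbT.
by rewrite supp_red // => /orP[/hx|/hy].
Qed.

Lemma perp_letter c d : letter d -> perp c d = indep c d.
Proof.
move=> ld; apply/perpP/idP => [h|h e]; first by apply: h; rewrite supp_letter // eqxx.
by rewrite supp_letter // => /eqP<-.
Qed.

Lemma perp_cons c d x : letter c -> ~~ init c^-1 x ->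
  perp d (c * x) = indep d c && perp d x.
Proof. by move=> lc n; rewrite perp_red ?(red_consP _ lc) // (perp_letter _ lc). Qed.

Lemma perp1 c : perp c 1. Proof. by apply/perpP => d; rewrite supp1. Qed.

Lemma perpV c x : perp c x^-1 = perp c x.
Proof.
have h z : perp c z -> perp c z^-1.
  by move=> /perpP h; apply/perpP => d; rewrite suppV => /h; rewrite indepV.
by apply/idP/idP => /h; rewrite ?invgK.
Qed.

Lemma perpVl c x : perp c^-1 x = perp c x.
Proof. by apply/perpP/perpP => h d /h; rewrite indepVl. Qed.

Lemma perp_comm c x : perp c x -> c * x = x * c.
Proof.
elim/len_ind: x => [|d x ld n IHx]; first by rewrite mul1g mulg1.
rewrite perp_cons // => /andP[/indep_comm e /IHx e'].
by rewrite mulgA e -!mulgA e'.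
Qed.

Lemma perp_initN c x : perp c x -> ~~ init c x.
Proof. by move=> /perpP h; apply/negP => /init_supp/h; rewrite indep_irr. Qed.

Lemma perp_init c x y : perp c x -> init c (x * y) = init c y.
Proof.
elim/len_ind: x => [|d x ld n IHx]; first by rewrite mul1g.
rewrite perp_cons // => /andP[h /IHx e].
by rewrite -mulgA indep_init // indepC.
Qed.

Lemma init_redl c x y : red x y -> init c x -> init c (x * y).
Proof.
move=> /eqP e /andP[lc h]; rewrite /init lc e /= mulgA.
by have := wlen_le (c^-1 * x) y; glia.
Qed.

Lemma init_red c x y : red x y -> init c (x * y) = init c x || perp c x && init c y.
Proof.
move=> r; apply/idP/orP => [|[|/andP[p i]]]; last 2 first.
- exact: init_redl.
- by rewrite perp_init.
elim/len_ind: x r => [|d x ld n IHx]; first by rewrite mul1g perp1 => _ ->; right.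
rewrite red_cons // => /andP[r n']; rewrite -mulgA.
case: (eqVneq c d) => [->|ncd i]; first by left; apply: initV.
have [icd /(IHx r)[ix|/andP[p iy]]] := initM ld n' ncd i.
  by left; rewrite indep_init.
by right; rewrite perp_cons // indepC icd p.
Qed.

(** * The prefix order, orthogonality and greatest lower bounds *)

Lemma preE x y : pre S x y <-> red x (x^-1 * y).
Proof. by rewrite /red /pre mulVKg; split=> [->|/eqP->]. Qed.

Lemma preP x y : pre S x y <-> exists2 r, y = x * r & red x r.
Proof.
split=> [/preE h|[r -> h]]; first by exists (x^-1 * y); rewrite ?mulVKg.
by apply/preE; rewrite mulKg.
Qed.

Lemma preM x y : red x y -> pre S x (x * y).
Proof. by move=> r; apply/preP; exists y. Qed.

Lemma pre_refl x : pre S x x.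
Proof. by apply/preP; exists 1; rewrite ?mulg1 ?red1. Qed.

Lemma pre1 x : pre S 1 x.
Proof. by apply/preP; exists x; rewrite ?mul1g ?redl. Qed.

Lemma pre_trans x y z : pre S x y -> pre S y z -> pre S x z.
Proof.
move=> /preP[r -> rx] /preP[s -> ry]; apply/preP; exists (r * s); rewrite ?mulgA //.
by move: ry; rewrite redA // => /andP[].
Qed.

Lemma pre_len x y : pre S x y -> (l x <= l y)%N.
Proof. by rewrite /pre => <-; rewrite leq_addr. Qed.

Lemma pre_anti x y : pre S x y -> pre S y x -> x = y.
Proof.
move=> h /pre_len; rewrite -h => le.
have /eqP : l (x^-1 * y) == 0%N by glia.
by move/eqP; rewrite wlen_eq0 mulg_eq1 => /eqP /invg_inj.
Qed.

Lemma pre_init c x y : pre S x y -> init c x -> init c y.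
Proof. by move=> /preP[r -> rx]; apply: init_redl. Qed.

Lemma pre_supp c x y : pre S x y -> supp c x -> supp c y.
Proof. by move=> /preP[r -> rx] s; rewrite supp_red // s. Qed.

Lemma pre_letter c g : letter c -> pre S c g <-> init c g.
Proof.
move=> lc; rewrite preE; split=> [|/initK[? _]]; last by rewrite red_consP.
by rewrite red_consP // => h; rewrite -(mulVKg c g) initV.
Qed.

Lemma pre_redl z x y : red z x -> red z y -> pre S (z * x) (z * y) <-> pre S x y.
Proof.
move=> /eqP e1 /eqP e2; rewrite /pre e1 e2 invgM -mulgA mulKg; glia.
Qed.

(** The first letter [c] of [x] begins the common bound but not [y], so it slides past all of [y];
    removing it from [x] and from the bound leaves [y] below the bound. *)
Lemma bounded_orthl x y z : pre S x z -> pre S y z ->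
  (forall c, init c x -> init c y -> False) -> orthl x y.
Proof.
elim/len_ind: x y z => [|c x lc n IHx] y z xz yz h.
  by apply/orthlP => d e; rewrite supp1.
have ic : init c z by apply: pre_init xz _; apply: initV.
case/preP: (yz) => r ez ry; move: ic; rewrite ez init_red // => /orP[|/andP[p ir]].
  by move/(h c (initV lc n)).
have [nr _] := initK ir; have rr : red c (c^-1 * r) by rewrite red_consP.
have yz' : pre S y (c^-1 * z).
  rewrite ez mulgA (perp_comm (_ : perp c^-1 y)) ?perpVl // -mulgA; apply: preM.
  rewrite -(mulVKg c r) in ry.
  by have [] := red_swap (esym (perp_comm p)) rr ry.
have xz' : pre S x (c^-1 * z).
  case/preP: xz => s -> rs; rewrite -mulgA mulKg; apply: preM.
  by move: rs; rewrite red_cons // => /andP[].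
have oxy : orthl x y.
  apply: IHx xz' yz' _ => d ix iy; apply: (h d) => //.
  by rewrite indep_init //; apply: (perpP _ _ p); apply: init_supp.
apply/orthlP => d e; rewrite supp_cons //.
by case/orP => [/eqP<-|]; [apply: (perpP _ _ p)|apply/orthlP: d e].
Qed.

Lemma orthlC x y : orthl x y = orthl y x.
Proof. by apply/orthlP/orthlP => h c d sc sd; rewrite indepC; apply: h. Qed.

Lemma orthl1 x : orthl x 1. Proof. by apply/orthlP => c d _; rewrite supp1. Qed.

Lemma orthl_perp x y c : orthl x y -> supp c x -> perp c y.
Proof. by move=> /orthlP h sc; apply/perpP => d; apply: h. Qed.

Lemma orthlV x y : orthl x y -> orthl x y^-1.
Proof. by move=> /orthlP h; apply/orthlP => c d sc; rewrite suppV => /(h c); rewrite indepV; apply. Qed.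

Lemma orthl_comm x y : orthl x y -> x * y = y * x.
Proof.
elim/len_ind: x => [|c x lc n IHx]; first by rewrite mul1g mulg1.
move=> /orthlP o; rewrite -mulgA IHx; last first.
  by apply/orthlP => d e sd; apply: o; rewrite supp_cons // sd orbT.
rewrite !mulgA (@perp_comm c y) //; apply/perpP => d; apply: o.
by rewrite supp_cons // eqxx.
Qed.

Lemma orthl_red x y : orthl x y -> red x y.
Proof.
move=> /orthlP o; apply/redP => c /init_supp; rewrite suppV => sc /init_supp sd.
by have := o _ _ sc sd; rewrite indepVl indep_irr.
Qed.

Lemma orthl_initN c x y : orthl x y -> init c x -> init c y -> False.
Proof. by move=> /orthlP h /init_supp ix /init_supp iy; have := h _ _ ix iy; rewrite indep_irr. Qed.

Lemma orthl_init c x y : orthl x y -> init c (x * y) = init c x || init c y.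
Proof.
move=> o; rewrite init_red ?orthl_red //; congr (_ || _).
apply: andb_idl => /init_supp s; rewrite orthlC in o.
exact: orthl_perp o s.
Qed.

Lemma orthl_lub x y : orthl x y -> is_lub S x y (x * y).
Proof.
move=> o; have r := orthl_red o; split.
- exact: preM.
- by rewrite orthl_comm //; apply: preM; apply: orthl_red; rewrite orthlC.
move=> t /preP[s ->]; elim/len_ind: y o s {r} => [|c y lc n IHy] o s rs.
  by rewrite mulg1 => _; apply: preM.
have pc : perp c x.
  by rewrite orthlC in o; apply: (orthl_perp o); rewrite supp_cons // eqxx.
have oxy : orthl x y.
  by apply/orthlP => d e sd se; apply: (orthlP _ _ o) => //; rewrite supp_cons // se orbT.
have rc : red c y by rewrite red_consP.
move=> h; have : init c (x * s) by apply: pre_init h _; apply: initV.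
rewrite perp_init // => js; have [ns _] := initK js.
have rcs : red c (c^-1 * s) by rewrite red_consP.
have rx : red c x by rewrite red_consP //; apply: perp_initN; rewrite perpVl.
have ex : x * s = c * (x * (c^-1 * s)) by rewrite mulgA (perp_comm pc) -mulgA mulVKg.
rewrite -(mulVKg c s) in rs.
have [r1 r2] := red_swap (esym (perp_comm pc)) rcs rs.
have [_ r3] := red_swap (esym (perp_comm pc)) rc (orthl_red o).
rewrite ex mulgA -(perp_comm pc) -mulgA; apply/pre_redl => //.
by apply: IHy => //; move: h; rewrite ex => /pre_redl; apply.
Qed.

(** Common first letters are collected one at a time. A common lower bound that does not begin with
    the collected letter [c] is independent of [c], hence still a lower bound once [c] is
    removed. *)
Lemma glb_ex x y : exists z, is_glb S x y z.
Proof.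
have [n] := ubnP (l x); elim: n => // n IHn in x y *; rewrite ltnS => lx.
have [[c [ix iy]]|no] := pselect (exists c, init c x /\ init c y); last first.
  exists 1; split=> [||t tx ty]; try exact: pre1.
  have [->|/init_ex[d id]] := eqVneq t 1; first exact: pre_refl.
  by case: no; exists d; split; apply: pre_init id.
have lc := letter_init ix; have [nx ex] := initK ix; have [ny ey] := initK iy.
have [|z [zx zy zm]] := IHn (c^-1 * x) (c^-1 * y); first by glia.
have rx : red c (c^-1 * x) by rewrite red_consP.
have ry : red c (c^-1 * y) by rewrite red_consP.
have rz : red c z.
  by case/preP: zx => s es rs; move: rx; rewrite es redA' // => /andP[].
exists (c * z); split.
- by rewrite -(mulVKg c x); apply/pre_redl.
- by rewrite -(mulVKg c y); apply/pre_redl.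
move=> t tx ty; have [it|nt] := boolP (init c t).
  have [nt et] := initK it; have rt : red c (c^-1 * t) by rewrite red_consP.
  rewrite -(mulVKg c t); apply/pre_redl => //; apply: zm.
    by apply/(pre_redl rt rx); rewrite !mulVKg.
  by apply/(pre_redl rt ry); rewrite !mulVKg.
have low g : pre S t g -> init c g -> perp c t /\ pre S t (c^-1 * g).
  case/preP => s -> rs; rewrite init_red // (negbTE nt) /= => /andP[p js]; split=> //.
  have [ns es] := initK js; have rcs : red c (c^-1 * s) by rewrite red_consP.
  rewrite mulgA (perp_comm (_ : perp c^-1 t)) ?perpVl // -mulgA; apply: preM.
  rewrite -(mulVKg c s) in rs.
  by have [] := red_swap (esym (perp_comm p)) rcs rs.
have [p tx'] := low _ tx ix; have [_ ty'] := low _ ty iy.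
have /preP[s es rs] := zm t tx' ty'.
have rct : red c t by rewrite red_consP // perp_initN // perpVl.
rewrite es mulgA (perp_comm p) -mulgA; apply: preM.
by rewrite es in rz; have [] := red_swap (perp_comm p) rs rz.
Qed.

(** * Meets, orthogonality and halfspaces *)

Lemma is_glb_meet x y : is_glb S x y (meet S x y).
Proof. by have [z zP] := glb_ex x y; apply: (@xgetPex _ 1 [set z | is_glb S x y z]); exists z. Qed.

Lemma meetE x y z : is_glb S x y z -> meet S x y = z.
Proof.
move=> [zx zy zm]; have [mx my mm] := is_glb_meet x y.
by apply: pre_anti; [apply: zm|apply: mm].
Qed.

Lemma meet1P x y : meet S x y = 1 <-> (forall c, init c x -> init c y -> False).
Proof.
split=> [e c ix iy|h].
  have [_ _ mm] := is_glb_meet x y; have lc := letter_init ix.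
  have := mm c; rewrite e !pre_letter // => /(_ ix iy).
  by rewrite init1.
apply: meetE; split=> [||t tx ty]; try exact: pre1.
have [->|/init_ex[c ic]] := eqVneq t 1; first exact: pre_refl.
by case: (h c); apply: pre_init ic.
Qed.

Lemma meet_red m x y : red m x -> red m y ->
  (forall c, init c x -> init c y -> False) -> meet S (m * x) (m * y) = m.
Proof.
move=> rx ry h; have [gx gy gm] := is_glb_meet (m * x) (m * y).
have /preP[s es rs] := gm m (preM rx) (preM ry).
rewrite es in gx gy *; move: gx gy => /(pre_redl rs rx) sx /(pre_redl rs ry) sy.
have [->|/init_ex[c ic]] := eqVneq s 1; first by rewrite mulg1.
by case: (h c); apply: pre_init ic.
Qed.

Lemma orthogonalP x y : orthogonal S x y <-> orthl x y.
Proof.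
split=> [[/meet1P h [z [xz yz _]]]|o]; first exact: bounded_orthl xz yz h.
split; last by exists (x * y); apply: orthl_lub.
by apply/meet1P => c; apply: orthl_initN.
Qed.

Lemma segmentE x y z : segment S x y z <-> red (x^-1 * z) (z^-1 * y).
Proof. by rewrite /segment /= preE invgM invgK -mulgA mulVKg. Qed.

Lemma segmentP x y z : segment S x y z <->
  (forall c, init c (z^-1 * x) -> init c (z^-1 * y) -> False).
Proof.
rewrite segmentE; split=> [/redP h c|h]; last apply/redP => c; rewrite ?invgM ?invgK.
  by have := h c; rewrite invgM invgK.
exact: h.
Qed.

Lemma segmentC x y z : segment S x y z -> segment S y x z.
Proof. by rewrite !segmentP => h c /[swap]; apply: h. Qed.

Lemma segmentM g x y z : segment S (g * x) (g * y) (g * z) <-> segment S x y z.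
Proof. by rewrite /segment /= !invgM -!mulgA !mulKg. Qed.

Lemma segmentl x y : segment S x y x.
Proof. by rewrite /segment /= mulVg; apply: pre1. Qed.

Lemma segmentr x y : segment S x y y.
Proof. exact/segmentC/segmentl. Qed.

Lemma qprecP w x y : qprec S w x y <->
  (forall c, init c (y^-1 * x) -> init c (w ^ y) -> False).
Proof. by rewrite /qprec segmentP. Qed.

(** For [q] a letter, this locates an edge crossing its wall; in general, [k] is a part of [x] by
    which conjugation has no effect on [q]. *)
Lemma split_orthl q x : exists k x',
  [/\ x = k * x', red k x', orthl q k & forall d, init d x' -> ~~ perp d q].
Proof.
have [n] := ubnP (l x); elim: n => // n IHn in x *; rewrite ltnS => lx.
have [[d [id pd]]|no] := pselect (exists d, init d x /\ perp d q); last first.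
  exists 1, x; split; rewrite ?mul1g ?redl ?orthl1 // => d id.
  by apply/negP => pd; apply: no; exists d.
have [nd ed] := initK id; have ld := letter_init id.
have [|k [x' [ex rx ox hx]]] := IHn (d^-1 * x); first by glia.
rewrite ex in nd; have ndk : ~~ init d^-1 k by apply: contraNN nd; apply: init_redl.
exists (d * k), x'; split => //.
- by rewrite -mulgA -ex mulVKg.
- by rewrite red_cons // rx.
apply/orthlP => a b sa; rewrite supp_cons // => /orP[/eqP <-|sb].
  by rewrite indepC; apply: (perpP _ _ pd).
exact: (orthlP _ _ ox).
Qed.

(* [init c] is the halfspace bounded by the wall of the edge from 1 to [c]. *)
Lemma segment_initN c x y z : letter c -> ~~ init c x -> ~~ init c y ->
  segment S x y z -> ~~ init c z.
Proof.
move=> lc nx ny /segmentP h; apply/negP => iz; have [nz ez] := initK iz.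
have rz : red c (c^-1 * z) by rewrite red_consP.
(* The way to [z] crosses the wall of [c] through the edge from [n] to [n * c], and [k] leads on
   from there. *)
have [n [k [ek rnk o hk]]] := split_orthl c (c^-1 * z).
have pn : perp c n by apply: (orthl_perp o); rewrite supp_letter.
have ez' : z = n * c * k by rewrite -(perp_comm pn) -mulgA -ek mulVKg.
rewrite ek in rz; have [rck _] := red_swap (perp_comm pn) rnk rz.
have lcV := letterVK lc; have nk : ~~ init c^-1 k by rewrite -red_consP.
(* From [z], the element [k^-1 * c^-1] leads back across the wall; its first letters also begin the
   way to every point on the other side. *)
have key a e : ~~ init c a -> init e (k^-1 * c^-1) -> init e (z^-1 * a).
  move=> na ie; have nt : ~~ init c (n^-1 * a) by rewrite perp_init // perpV.
  have rt : red c^-1 (n^-1 * a) by rewrite red_consP // invgK.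
  have rk : red k^-1 (c^-1 * (n^-1 * a)).
    apply/redP => d; rewrite invgK => dk dt.
    have ndc : d != c^-1 by apply: contraNneq nk => <-.
    have [|i _] := initM lcV _ ndc dt; first by rewrite invgK.
    by move: (hk d dk); rewrite perp_letter // indepC -indepVl i.
  rewrite ez' !invgM -!mulgA (mulgA k^-1); apply: init_redl => //.
  by move: rk; rewrite redA' // => /andP[].
have : k^-1 * c^-1 != 1.
  rewrite -wlen_eq0 -invgM wlenV; move/eqP: rck => ->.
  by rewrite wlen_letter.
by case/init_ex => e ie; apply: (h e); apply: key.
Qed.

Lemma segment_init c x y z : init c x -> init c y -> segment S x y z -> init c z.
Proof.
move=> ix iy; have lc := letter_init ix; have lcV := letterVK lc.
have [nx _] := initK ix; have [ny _] := initK iy.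
rewrite -(segmentM c^-1) => /(segment_initN lcV nx ny) nz.
by rewrite -(mulVKg c z); apply: initV.
Qed.

Lemma segment_convex a b : convex S (segment S a b).
Proof.
move=> x y hx hy z /segmentP hz; apply/segmentP => c ia ib; apply: (hz c).
  by apply: (segment_init ia ib); apply/segmentM.
by apply: (segment_init ia ib); apply/segmentM.
Qed.

Lemma bounded_split x y z : pre S x z -> pre S y z -> exists m x' y',
  [/\ x = m * x', y = m * y', red m x', red m y' & orthl x' y'].
Proof.
have [] := is_glb_meet x y; move: (meet S x y) => m /preP[x' -> rx] /preP[y' -> ry] mm.
move=> xz yz; exists m, x', y'; split=> //.
have nc c : init c x' -> init c y' -> False.
  move=> ix iy; have lc := letter_init ix.
  have rx1 : red c (c^-1 * x') by rewrite red_consP //; case: (initK ix).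
  have ry1 : red c (c^-1 * y') by rewrite red_consP //; case: (initK iy).
  rewrite -(mulVKg c x') redA' // in rx; rewrite -(mulVKg c y') redA' // in ry.
  case/andP: rx => rx rx2; case/andP: ry => ry ry2.
  have := mm (m * c); rewrite -{1}(mulVKg c x') -{1}(mulVKg c y') (mulgA m c) (mulgA m c).
  move=> /(_ (preM rx2) (preM ry2)) /pre_len.
  by rewrite (eqP rx) (wlen_letter (letter_init ix)); lia.
have mz : pre S m z by apply: pre_trans xz; apply: preM.
case/preP: mz => t et rt; apply: (@bounded_orthl _ _ t) => //.
  by apply/(pre_redl rx rt); rewrite -et.
by apply/(pre_redl ry rt); rewrite -et.
Qed.

Lemma cnt_indep c d x y z : pre S x z -> pre S y z ->
  (cnt c y < cnt c x)%N -> (cnt d x < cnt d y)%N -> indep c d.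
Proof.
move=> xz yz; have [m [x' [y' [-> -> rx ry o]]]] := bounded_split xz yz.
rewrite !cnt_red // => h1 h2; apply: (orthlP _ _ o); rewrite /supp; lia.
Qed.

(** Letter counts separate elements only under a common bound: after removal of the meet the
    remainders are orthogonal and have the same letters, hence are trivial. *)
Lemma cnt_inj x y z : pre S x z -> pre S y z ->
  (forall c, cnt c x = cnt c y) -> x = y.
Proof.
move=> xz yz; have [m [x' [y' [-> -> rx ry o]]]] := bounded_split xz yz => e.
have e' c : supp c x' = supp c y'.
  by have := e c; rewrite !cnt_red // /supp => /addnI->.
have x1 : x' = 1.
  apply/eqP/negPn/negP => /init_ex[c /init_supp sx].
  by have := orthlP _ _ o c c sx; rewrite -e' sx indep_irr => /(_ isT).
have y1 : y' = 1.
  apply/eqP/negPn/negP => /init_ex[c /init_supp].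
  by rewrite -e' x1 supp1.
by rewrite x1 y1.
Qed.

Lemma crP v : reflect (forall c, init c v -> init c v^-1 -> False) (red v v).
Proof. by apply: (iffP (redP _ _)) => h c /[swap]; apply: h. Qed.

Lemma crV v : red v v -> red v^-1 v^-1.
Proof. exact: redV. Qed.

Lemma cr_pow v n : red v v ->
  red v (v ^+ n) /\ forall c, init c (v ^+ n) -> init c v.
Proof.
move=> cv; elim: n => [|n [IH1 IH2]]; first by rewrite expg0 red1; split=> // c; rewrite init1.
have h c : init c (v ^+ n.+1) -> init c v.
  by rewrite expgS init_red // => /orP[//|/andP[_ /IH2]].
by split=> //; apply/redP => c iV /h; apply/redP: c iV.
Qed.

Lemma wlenX v n : red v v -> l (v ^+ n) = (n * l v)%N.
Proof.
move=> cv; elim: n => [|n IHn]; first by rewrite expg0 wlen1.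
by rewrite expgS (eqP (proj1 (cr_pow n cv))) IHn mulSn.
Qed.

Lemma cntX c v n : red v v -> cnt c (v ^+ n) = (n * cnt c v)%N.
Proof.
move=> cv; elim: n => [|n IHn]; first by rewrite expg0 cnt1.
by rewrite expgS (cnt_red _ (proj1 (cr_pow n cv))) IHn mulSn.
Qed.

Lemma suppX c v n : red v v -> (0 < n)%N -> supp c (v ^+ n) = supp c v.
Proof. by move=> cv n0; rewrite /supp cntX // muln_gt0 n0. Qed.

Lemma red_pow v m n : red v v -> red (v ^+ m) (v ^+ n).
Proof. by move=> cv; rewrite /red -expgnDr !wlenX // mulnDl. Qed.

Lemma cr_initX c v n : red v v -> (0 < n)%N -> init c (v ^+ n) = init c v.
Proof.
case: n => // n cv _; apply/idP/idP; first by case: (cr_pow n.+1 cv) => _; apply.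
by rewrite expgS; apply: init_redl; case: (cr_pow n cv).
Qed.

Lemma pre_pow v m n : red v v -> (m <= n)%N -> pre S (v ^+ m) (v ^+ n).
Proof. by move=> cv mn; rewrite -(subnKC mn) expgnDr; apply/preM/red_pow. Qed.

(** * Conjugation of cyclically reduced elements *)

(* For [v] cyclically reduced, this says that conjugation by [c] preserves its
   length. *)
Definition fixable c v : bool := [|| init c v, init c v^-1 | perp c v].

(** Under this condition nothing cancels in [x^-1 * v * x]; see [wlen_conjred]. *)
Definition conjred v x : Prop := forall c, init c x -> ~~ fixable c v.

Lemma fixableV c v : fixable c v^-1 = fixable c v.
Proof. by rewrite /fixable invgK perpV orbCA. Qed.

Lemma conjredV v x : conjred v x -> conjred v^-1 x.
Proof. by move=> h c /h; rewrite fixableV. Qed.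

Lemma perpX c v n : red v v -> (0 < n)%N -> perp c (v ^+ n) = perp c v.
Proof. by move=> cv n0; apply/perpP/perpP => h d; have := h d; rewrite suppX. Qed.

Lemma fixableX c v n : red v v -> (0 < n)%N -> fixable c (v ^+ n) = fixable c v.
Proof.
move=> cv n0; rewrite /fixable -expVgn perpX //.
by rewrite !cr_initX //; apply: crV.
Qed.

Lemma conjredX v x n : red v v -> (0 < n)%N -> conjred v x -> conjred (v ^+ n) x.
Proof. by move=> cv n0 h c /h; rewrite fixableX. Qed.

Lemma conjred_redl v x : conjred v x -> red x^-1 v.
Proof. by move=> h; apply/redP => c; rewrite invgK => /h; rewrite /fixable => /norP[/negP]. Qed.

Lemma conjred_redr v x : conjred v x -> red v x.
Proof. by move=> /conjredV/conjred_redl/redV; rewrite !invgK. Qed.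

Lemma conjred_init_mul c v x : conjred v x -> init c (v * x) -> init c x -> False.
Proof.
move=> h; rewrite init_red; last exact: conjred_redr.
by move=> + /h; rewrite /fixable => /orP[->//|/andP[->]]; rewrite !orbT.
Qed.

Lemma conjred_red v x : conjred v x -> red x^-1 (v * x).
Proof.
by move=> h; apply/redP => c; rewrite invgK => ix ivx; apply: (conjred_init_mul h ivx).
Qed.

Lemma wlen_conjred v x : conjred v x -> l (v ^ x) = (2 * l x + l v)%N.
Proof.
move=> h; rewrite /conjg (eqP (conjred_red h)) wlenV (eqP (conjred_redr h)); lia.
Qed.

Lemma init_conjred c v x : conjred v x -> init c (v ^ x) = init c (x^-1 * v).
Proof.
move=> h; have r := conjred_red h; rewrite /conjg mulgA.
have r' : red (x^-1 * v) x by move: r; rewrite redA' ?(conjred_redr h) // => /andP[].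
rewrite init_red //; apply/orb_idr => /andP[]; rewrite perp_red ?(conjred_redl h) //.
by rewrite perpV => /andP[/perp_initN/negbTE->].
Qed.

Lemma wlen_conj_init c g : init c g -> (l (g ^ c) <= l g)%N.
Proof.
move=> i; have [_ ->] := initK i; rewrite /conjg mulgA.
apply: leq_trans (wlen_le _ _) _; rewrite (wlen_letter (letter_init i)); glia.
Qed.

Lemma supp_conj_init c d g : init c g -> l (g ^ c) = l g -> supp d (g ^ c) = supp d g.
Proof.
move=> i; have [n ->] := initK i; have lc := letter_init i.
rewrite /conjg mulgA => e.
have r : red (c^-1 * g) c by rewrite /red e (wlen_letter lc); glia.
by rewrite supp_red // (supp_letter _ lc) -{2}(mulVKg c g) supp_cons // orbC.
Qed.

Lemma wlen_conj_drop c g : init c g -> init c g^-1 -> (l (g ^ c)).+2 = l g.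
Proof.
move=> i iV; have [n ->] := initK i; have lc := letter_init i.
have r : red c (c^-1 * g) by rewrite red_consP.
have i' : init c (c^-1 * g)^-1.
  move: iV; rewrite -{1}(mulVKg c g) invgM init_red; last by have := redV r; rewrite invgM.
  case/orP => // /andP[_ /init_supp]; rewrite supp_letter ?letterV // => /eqP e.
  by have := letter_neqV lc; rewrite {1}e eqxx.
have [_] := initK i'; rewrite wlenV => ->; rewrite -wlenV !invgM !invgK /conjg.
by rewrite !mulgA.
Qed.

Lemma cr_conj_init c v : init c v -> red v v ->
  [/\ red (v ^ c) (v ^ c), l (v ^ c) = l v & forall d, supp d (v ^ c) = supp d v].
Proof.
move=> i cv; have lc := letter_init i; have [n ev] := initK i.
(* The cube of [v] is regrouped as [c * (v ^ c * v ^ c * (c^-1 * v))]. Its length [3 * l v] leaves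
   no slack, so [v ^ c] keeps the length and its square is reduced. *)
have e3 := wlenX 3 cv; have lec := wlen_conj_init i.
have h1 := wlen_le c (v ^ c * v ^ c * (c^-1 * v)).
have h2 := wlen_le (v ^ c * v ^ c) (c^-1 * v).
have h3 := wlen_le (v ^ c) (v ^ c).
have e : c * (v ^ c * v ^ c * (c^-1 * v)) = v ^+ 3.
  by rewrite !expgS expg0 /conjg !gnorm.
have l1 := wlen_letter lc; rewrite e e3 in h1.
have le : l (v ^ c) = l v by glia.
split => //; first by apply/eqP; glia.
by move=> d; apply: supp_conj_init.
Qed.

Lemma cr_conj_fixable c v : letter c -> fixable c v -> red v v ->
  [/\ red (v ^ c) (v ^ c), l (v ^ c) = l v & forall d, supp d (v ^ c) = supp d v].
Proof.
move=> lc /or3P[i|i|p] cv; first exact: cr_conj_init.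
  have [r e s] := cr_conj_init i (crV cv); split.
  - by have := crV r; rewrite -conjVg invgK.
  - by rewrite -wlenV -conjVg e wlenV.
  - by move=> d; have := s d^-1; rewrite conjVg !suppV !invgK.
by have -> : v ^ c = v by rewrite /conjg -(perp_comm p) mulKg.
Qed.

Lemma conj_split v x : red v v -> exists k x',
  [/\ x = k * x', red (v ^ k) (v ^ k), l (v ^ k) = l v & conjred (v ^ k) x'].
Proof.
have [n] := ubnP (l x); elim: n => // n IHn in v x *; rewrite ltnS => lx cv.
have [[d [id fd]]|no] := pselect (exists d, init d x /\ fixable d v); last first.
  exists 1, x; rewrite mul1g conjg1; split=> // c ic.
  by apply/negP => fc; apply: no; exists c.
have [nd ed] := initK id; have ld := letter_init id.
have [r e _] := cr_conj_fixable ld fd cv.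
have [|k [x' [ex rk ek hx]]] := IHn (v ^ d) (d^-1 * x) _ r; first by glia.
exists (d * k), x'; rewrite conjgM; split=> //; last by rewrite ek.
by rewrite -mulgA -ex mulVKg.
Qed.

Lemma cr_wlen_min v x : red v v -> (l v <= l (v ^ x))%N.
Proof.
move=> cv; have [k [x' [-> rk ek hx]]] := conj_split x cv.
by rewrite conjgM wlen_conjred // ek; lia.
Qed.

Lemma cr_wlen v x : red v v -> red (v ^ x) (v ^ x) -> l (v ^ x) = l v.
Proof.
move=> cv cvx; apply/eqP; rewrite eqn_leq cr_wlen_min // andbT.
by have := cr_wlen_min x^-1 cvx; rewrite conjgK.
Qed.

Lemma cr_ex g : exists a, red (g ^ a) (g ^ a).
Proof.
have [n] := ubnP (l g); elim: n => // n IHn in g *; rewrite ltnS => lg.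
have [r|] := boolP (red g g); first by exists 1; rewrite conjg1.
case/(redP _ _)/existsNP => c /not_implyP[iV] /not_implyP[i _].
have e := wlen_conj_drop i iV.
have [|a ra] := IHn (g ^ c); first by glia.
by exists (c * a); rewrite conjgM.
Qed.

Lemma conj_form g : exists v x, [/\ g = v ^ x, red v v & conjred v x].
Proof.
have [a ra] := cr_ex g; have [k [x [e rk _ h]]] := conj_split a^-1 ra.
exists ((g ^ a) ^ k), x; split=> //.
by rewrite -conjgM -e conjgK.
Qed.

(** Writing [g] as [v ^ x] without cancellation, the first letters are those of [x^-1 * v], and [v]
    has the same first letters as its powers. *)
Lemma initX c g n : (0 < n)%N -> init c (g ^+ n) = init c g.
Proof.
have [v [x [-> cv h]]] := conj_form g => n0.
have h' := conjredX cv n0 h.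
by rewrite -conjXg !init_conjred // !init_red ?conjred_redl // cr_initX.
Qed.

Lemma cr_root g n : (0 < n)%N -> red (g ^+ n) (g ^+ n) -> red g g.
Proof.
move=> n0 /crP h; apply/crP => c i iV; apply: (h c); first by rewrite initX.
by rewrite -expVgn initX.
Qed.

(** At a point where [x] is cyclically reduced, both roots are prefixes of the common power and have
    equal letter counts, so [cnt_inj] applies. *)
Lemma root_inj x y n : (0 < n)%N -> x ^+ n = y ^+ n -> x = y.
Proof.
move=> n0 e; have [a ra] := cr_ex x; apply: (@conjg_inj _ a).
have {}e : (x ^ a) ^+ n = (y ^ a) ^+ n by rewrite -!conjXg e.
move: (x ^ a) (y ^ a) ra e => {}x {}y rx e.
have ry : red y y by apply: (cr_root n0); rewrite -e; apply: red_pow.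
apply: (@cnt_inj _ _ (x ^+ n)).
- by rewrite -{1}(expg1 x); apply: pre_pow.
- by rewrite e -{1}(expg1 y); apply: pre_pow.
move=> c; have /eqP := congr1 (cnt c) e; rewrite !cntX // eqn_pmul2l //.
by move/eqP.
Qed.

Lemma commute_root g x n : (0 < n)%N -> commute g (x ^+ n) -> commute g x.
Proof.
move=> n0 h; suff e : x ^ g = x by rewrite /commute [RHS]conjgC e.
apply: (root_inj n0); rewrite -conjXg /conjg -h.
exact: mulKg.
Qed.

(** The meet in the median is [y^-1 * v^-1]: [phi] strips from [x] the part [y] that keeps [w ^ x]
    from being cyclically reduced. *)
Lemma phiE w x v y : w ^ x = v ^ y -> red v v -> conjred v y -> phi S w x = x * y^-1.
Proof.
move=> e cv h; have hV := conjredV h; rewrite /phi /median.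
have -> : (w * x)^-1 * x = y^-1 * v^-1 * y.
  have -> : (w * x)^-1 * x = (w ^ x)^-1 by rewrite /conjg !gnorm.
  by rewrite e /conjg !gnorm.
have -> : (w * x)^-1 * (w^-1 * x) = y^-1 * v^-1 * (v^-1 * y).
  have -> : (w * x)^-1 * (w^-1 * x) = (w ^ x)^-1 * (w ^ x)^-1.
    by rewrite /conjg !gnorm.
  by rewrite e /conjg !gnorm.
have r1 : red (y^-1 * v^-1) y.
  by move: (conjred_red hV); rewrite redA' ?(conjred_redr hV) // => /andP[].
have r2 : red (y^-1 * v^-1) (v^-1 * y).
  have h2 := conjredX (crV cv) (isT : 0 < 2)%N hV.
  have rvv : red v^-1 v^-1 by exact: crV.
  have := conjred_red h2; have := conjred_redr h2; rewrite expg2 => r2.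
  rewrite -mulgA redA' //; last by move: r2; rewrite redA // => /andP[].
  by case/andP.
rewrite (meet_red r1 r2) => [|c iy ivy]; last exact: (conjred_init_mul hV ivy iy).
have -> : w = v ^ (y * x^-1) by rewrite conjgM -e conjgK.
by rewrite /conjg !gnorm.
Qed.

Lemma X_P w x : X_ S w x <-> red (w ^ x) (w ^ x).
Proof.
split=> [[z _ <-]|cwx].
  have [v [y [e cv h]]] := conj_form (w ^ z).
  by rewrite (phiE e cv h) conjgM e conjgK.
exists x => //; rewrite (@phiE w x (w ^ x) 1) ?invg1 ?mulg1 ?conjg1 //.
by move=> c; rewrite init1.
Qed.

(** Conjugation by [e] at most moves one occurrence of [e] or its inverse between the ends of [v],
    which does not affect the independent letter [c]. *)
Lemma fixable_conj c e v : fixable e v -> indep e c -> red v v -> letter e ->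
  letter c -> fixable c (v ^ e) -> fixable c v.
Proof.
move=> + iec; have iec' : indep e^-1 c by rewrite indepVl.
have nce : c != e by apply: contraTneq iec => ->; rewrite indep_irr.
have key u : init e u -> red u u -> letter e -> letter c ->
    fixable c (u ^ e) -> fixable c u.
  move=> i cu le lc; have [_ eu s] := cr_conj_init i cu; have [n en] := initK i.
  have r : red (e^-1 * u) e.
    by rewrite /red -mulgA -/(conjg u e) eu en (wlen_letter le); glia.
  have lu : u ^ e = e^-1 * u * e by rewrite /conjg mulgA.
  case/or3P => [|j|/perpP p].
  - rewrite lu init_red // (indep_init _ (letterVK le) iec') => /orP[j|/andP[_ /init_supp]].
      by rewrite /fixable j.
    by rewrite supp_letter // eq_sym (negbTE nce).
  - move: j; rewrite lu invgM (indep_init _ (letterVK le) iec') => j.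
    have re : red e (e^-1 * u) by rewrite red_consP.
    have : init c u^-1 by rewrite -(mulVKg e u) invgM; apply: init_redl (redV re) j.
    by rewrite /fixable => ->; rewrite orbT.
  - have pu : perp c u by apply/perpP => d; rewrite -s; apply: p.
    by rewrite /fixable pu !orbT.
case/or3P => [i|i|p] cv le lc; first exact: key.
  by rewrite -fixableV -conjVg => /(key _ i (crV cv) le lc); rewrite fixableV.
by have -> : v ^ e = v by rewrite /conjg -(perp_comm p) mulKg.
Qed.

(* If conjugation by [c] lengthened [v], then so would conjugation by every
   element starting with [c]. *)
Lemma cr_fixable_first c v x : red v v -> init c x -> (l (v ^ x) <= l v)%N ->
  fixable c v.
Proof.
have [n] := ubnP (l x); elim: n => // n IHn in v x *; rewrite ltnS => lx cv ic h.
have [[d [id fd]]|no] := pselect (exists d, init d x /\ fixable d v); last first.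
  have hc : conjred v x by move=> d id; apply/negP => fd; apply: no; exists d.
  move: h; rewrite wlen_conjred // => h.
  by have [_] := initK ic; glia.
have [->//|ncd] := eqVneq c d.
have [nd ed] := initK id; have ld := letter_init id; have lc := letter_init ic.
have [r e _] := cr_conj_fixable ld fd cv.
move: ic; rewrite -{1}(mulVKg d x) => /(initM ld nd ncd) [idc ic].
apply: (fixable_conj fd) => //; apply: (IHn _ (d^-1 * x)) => //; first by glia.
by rewrite -conjgM mulVKg e.
Qed.

(** * Orthogonal families *)

Lemma orthlVl x y : orthl x y -> orthl x^-1 y.
Proof. by rewrite orthlC => /orthlV; rewrite orthlC. Qed.

Lemma orthl_supp x y x' y' : (forall c, supp c x' -> supp c x) ->
  (forall c, supp c y' -> supp c y) -> orthl x y -> orthl x' y'.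
Proof. by move=> hx hy /orthlP o; apply/orthlP => c d /hx sc /hy sd; apply: o. Qed.

Lemma supp_mul c x y : supp c (x * y) -> supp c x || supp c y.
Proof.
elim/len_ind: x => [|e x le n IHx]; first by rewrite mul1g supp1.
rewrite (supp_cons c le n) -orbA; case: (eqVneq e c) => //= nec; rewrite -mulgA => sc.
apply: IHx; move: sc; have [i|ni] := boolP (init e^-1 (x * y)).
  rewrite -{2}(mulKg e (x * y)) supp_cons ?letterV //; first by move=> ->; rewrite orbT.
  by have [] := initK i; rewrite invgK.
by rewrite (supp_cons c le ni) (negbTE nec).
Qed.

Lemma supp_expg c x n : supp c (x ^+ n) -> supp c x.
Proof.
elim: n => [|n IHn]; first by rewrite expg0 supp1.
by rewrite expgS => /supp_mul/orP[].
Qed.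

Lemma orthl_mulr x y z : orthl x y -> orthl x z -> orthl x (y * z).
Proof.
move=> /orthlP oy /orthlP oz; apply/orthlP => c d sc /supp_mul/orP[].
  exact: oy.
exact: oz.
Qed.

Lemma orthl_crl x y : orthl x y -> red (x * y) (x * y) -> red x x.
Proof.
move=> o /crP h; apply/crP => c i iV; apply: (h c); first by rewrite orthl_init ?i.
rewrite (orthl_comm o) invgM orthl_init ?iV //.
exact/orthlVl/orthlV.
Qed.

Lemma orthl_cr x y : orthl x y -> red x x -> red y y -> red (x * y) (x * y).
Proof.
move=> o /crP hx /crP hy; have oV := orthlVl (orthlV o).
apply/crP => c; rewrite (orthl_comm o) invgM -(orthl_comm o).
rewrite !orthl_init // => /orP[ix|iy] /orP[jx|jy].
- exact: hx ix jx.
- exact: orthl_initN (orthlV o) ix jy.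
- by apply: orthl_initN jx iy; apply: orthlVl.
- exact: hy iy jy.
Qed.

Lemma fixable_orthl c x y : orthl x y -> fixable c (x * y) = fixable c x && fixable c y.
Proof.
move=> o; have oV := orthlVl (orthlV o); have o' := o; rewrite orthlC in o'.
rewrite /fixable perp_red ?orthl_red // {2}(orthl_comm o) invgM !orthl_init //.
have pxy : init c x -> perp c y by move=> /init_supp; apply: orthl_perp.
have pyx : init c y -> perp c x by move=> /init_supp; apply: orthl_perp.
have pxyV : init c x^-1 -> perp c y.
  by move=> /init_supp; apply: orthl_perp; apply: orthlVl.
have pyxV : init c y^-1 -> perp c x.
  by move=> /init_supp; apply: orthl_perp; apply: orthlVl.
move: pxy pyx pxyV pyxV.
by case: (init c x) (init c y) (init c x^-1) (init c y^-1) (perp c x) (perp c y)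
  => [] [] [] [] [] [] a b d e //; move: (a isT) || move: (b isT) || move: (d isT) || move: (e isT).
Qed.

Section Families.
Variable I : eqType.

Definition orth_family (p : I -> G) (r : seq I) : Prop :=
  (forall i, i \in r -> red (p i) (p i)) /\
  (forall i j, i \in r -> j \in r -> i != j -> orthl (p i) (p j)).

(** By [cr_fixable_first], already the first letter of [x] lengthens no member. Such a conjugation
    preserves supports, hence orthogonality, and the rest of [x] follows by induction. *)
Lemma orth_family_conj (p : I -> G) (r : seq I) x : orth_family p r ->
  (forall i, i \in r -> (l (p i ^ x) <= l (p i))%N) ->
  orth_family (fun i => p i ^ x) r.
Proof.
have [n] := ubnP (l x); elim: n => // n IHn in p x *; rewrite ltnS => lx [hc ho] hl.
have [->|/init_ex[c ic]] := eqVneq x 1.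
  by split=> [i|i j]; rewrite !conjg1; [apply: hc|apply: ho].
have [_ ec] := initK ic; have lc := letter_init ic.
have hf (i : I) : i \in r -> [/\ red (p i ^ c) (p i ^ c), l (p i ^ c) = l (p i)
    & forall d, supp d (p i ^ c) = supp d (p i)].
  move=> ir; apply: cr_conj_fixable => //; last exact: hc.
  by apply: cr_fixable_first ic (hl i ir); apply: hc.
have [|||hc' ho'] := IHn (fun i => p i ^ c) (c^-1 * x).
- by glia.
- split=> [i /hf[]//|i j ir jr ij]; have [_ _ si] := hf i ir; have [_ _ sj] := hf j jr.
  by apply: orthl_supp (ho i j ir jr ij) => d; rewrite ?si ?sj.
- by move=> i ir; rewrite -conjgM mulVKg; have [_ -> _] := hf i ir; apply: hl.
split=> [i /hc'|i j ir jr ij]; first by rewrite -conjgM mulVKg.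
by have := ho' i j ir jr ij; rewrite -!conjgM mulVKg.
Qed.

End Families.

(** A first letter of [y] that is fixable for [p] but not independent of it occurs in [p] or its
    inverse, so it is independent of [k] and [q] and would be a fixable first letter of [x]. *)
Lemma conjred_orthl p q x : orthl p q -> conjred (p * q) x ->
  exists k y, [/\ x = k * y, red k y, orthl p k & conjred p y].
Proof.
move=> o h; have [k [y [ex r ok hy]]] := split_orthl p x.
exists k, y; split=> // c iy; apply/negP => fc.
suff [pk pq] : perp c k /\ perp c q.
  move: (h c); rewrite ex perp_init // => /(_ iy); rewrite fixable_orthl // fc.
  by rewrite /fixable pq !orbT.
case/or3P: fc => [/init_supp s|/init_supp s|pc]; last by move: (hy c iy); rewrite pc.
  by split; apply: orthl_perp s.
by split; apply: (orthl_perp _ s); apply: orthlVl.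
Qed.

Lemma orthl_conj_comm p k y : orthl p k -> p ^ (k * y) = p ^ y.
Proof. by move=> o; rewrite conjgM {2}/conjg (orthl_comm o) mulKg. Qed.

Lemma init_conj_redl c p q x : orthl p q -> conjred (p * q) x ->
  init c (p ^ x) -> init c ((p * q) ^ x).
Proof.
move=> o h; have [k [y [ex r ok hy]]] := conjred_orthl o h.
rewrite {1}ex (orthl_conj_comm _ ok) !init_conjred //.
(* The length of the left side is the sum of the lengths of the four pieces on the right, so nothing
   cancels between the two factors. *)
have e : x^-1 * (p * q) = y^-1 * p * (k^-1 * q).
  by rewrite ex invgM -!mulgA; congr (_ * _); rewrite !mulgA (orthl_comm (orthlV ok)).
rewrite e; apply: init_redl; apply/eqP; rewrite -e.
have := wlen_le (y^-1 * p) (k^-1 * q); rewrite -e.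
have := conjred_redl h; rewrite /red => /eqP ->.
have := wlen_le y^-1 p; have := wlen_le k^-1 q.
by rewrite !wlenV ex (eqP r) (eqP (orthl_red o)); glia.
Qed.

(** Letters of [x] that are fixable for the product are conjugated away first. Then a first letter
    of the conjugate comes from a factor or from [x^-1], and in the latter case from the parts of
    [x] that the factors absorb. *)
Lemma init_conj_orthl c p q x : red p p -> red q q -> orthl p q ->
  init c ((p * q) ^ x) = init c (p ^ x) || init c (q ^ x).
Proof.
have [n] := ubnP (l x); elim: n => // n IHn in p q x *; rewrite ltnS => lx cp cq o.
have [[d [id fd]]|no] := pselect (exists d, init d x /\ fixable d (p * q)).
  have [_ ed] := initK id; have ld := letter_init id.
  move: fd; rewrite fixable_orthl // => /andP[fp fq].
  have [rp _ sp] := cr_conj_fixable ld fp cp; have [rq _ sq] := cr_conj_fixable ld fq cq.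
  have := IHn (p ^ d) (q ^ d) (d^-1 * x) _ rp rq.
  rewrite -conjMg -!conjgM mulVKg; apply; first by glia.
  by apply: orthl_supp o => e; rewrite ?sp ?sq.
have h : conjred (p * q) x by move=> d id; apply/negP => fd; apply: no; exists d.
have o' := o; rewrite orthlC in o'; have h' := h; rewrite (orthl_comm o) in h'.
apply/idP/orP => [|[]]; last 2 first.
- exact: init_conj_redl.
- by rewrite (orthl_comm o); apply: init_conj_redl.
have [k [y [ex r ok hy]]] := conjred_orthl o h.
have [k' [y' [ex' r' ok' hy']]] := conjred_orthl o' h'.
have key u j z : x = j * z -> red j z -> orthl u j -> conjred u z ->
    init c (z^-1 * u) -> init c (u ^ x).
  by move=> -> rjz ouj hz; rewrite orthl_conj_comm // init_conjred.
rewrite init_conjred // init_red ?conjred_redl // perpV => /orP[ix|/andP[px]]; last first.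
  rewrite orthl_init // => /orP[i|i].
    left; apply: (key _ _ _ ex r ok hy); move: px; rewrite ex perp_red // => /andP[_ py].
    by rewrite perp_init // perpV.
  right; apply: (key _ _ _ ex' r' ok' hy'); move: px; rewrite ex' perp_red // => /andP[_ py].
  by rewrite perp_init // perpV.
have split u j z : x = j * z -> red j z -> orthl u j -> conjred u z ->
    init c (u ^ x) \/ init c j^-1.
  move=> e rjz ouj hz; move: ix; rewrite e invgM init_red; last exact: redV.
  case/orP => [i|/andP[_ i]]; last by right.
  by left; rewrite -e; apply: (key _ _ _ e rjz ouj hz); apply: init_redl i; apply: conjred_redl.
case: (split _ _ _ ex r ok hy) => [?|ik]; first by left.
case: (split _ _ _ ex' r' ok' hy') => [?|ik']; first by right.
(* Now [c] begins both [k^-1] and [k'^-1]. A common first letter of [k] and [k'] would be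
   independent of [p] and [q], against [h]; without one, [k] and [k'] are orthogonal, and so are
   their inverses. *)
have kx : pre S k x by rewrite ex; apply: preM.
have kx' : pre S k' x by rewrite ex'; apply: preM.
have [g [a [b [ek ek' ra rb oab]]]] := bounded_split kx kx'.
have [g1|/init_ex[d id]] := eqVneq g 1.
  rewrite g1 !mul1g in ek ek'; rewrite -ek -ek' in oab.
  by case: (orthl_initN (orthlVl (orthlV oab)) ik ik').
have dk : init d k by rewrite ek init_redl.
have dk' : init d k' by rewrite ek' init_redl.
have := h d (pre_init kx dk); rewrite fixable_orthl // /fixable.
rewrite (orthl_perp _ (init_supp dk)) ?(orthl_perp _ (init_supp dk')) ?orbT //.
  by rewrite orthlC.
by rewrite orthlC.
Qed.

Section FamilyProducts.
Variable I : eqType.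
Variables (p : I -> G) (m : I -> nat).

Lemma orth_family_prod (r : seq I) : uniq r -> orth_family p r ->
  (forall i, i \in r -> (0 < m i)%N) ->
  let v := \prod_(i <- r) p i ^+ m i in
  [/\ red v v, forall c, supp c v = has (fun i => supp c (p i)) r,
    forall c x, init c (v ^ x) = has (fun i => init c (p i ^ x)) r
    & forall c x, init c (v^-1 ^ x) = has (fun i => init c ((p i)^-1 ^ x)) r].
Proof.
elim: r => [|i r IHr] /=.
  move=> _ _ _; rewrite big_nil; split=> [|c|c x|c x]; rewrite ?red1 ?supp1 //.
    by rewrite conj1g init1.
  by rewrite invg1 conj1g init1.
move=> /andP[nir ur] [hc ho] hm; rewrite big_cons.
have [||cv sv iv ivV] := IHr ur.
- split=> [j jr|j k jr kr]; first by apply: hc; rewrite inE jr orbT.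
  by apply: ho; rewrite inE ?jr ?kr orbT.
- by move=> j jr; apply: hm; rewrite inE jr orbT.
move: (\prod_(j <- r) p j ^+ m j) cv sv iv ivV => v cv sv iv ivV.
have ir : i \in i :: r by rewrite inE eqxx.
have mi := hm i ir; have ci := hc i ir; have cim := red_pow (m i) (m i) ci.
have o : orthl (p i ^+ m i) v.
  apply/orthlP => c d; rewrite suppX // sv => sc /hasP[j jr sd].
  have ij : i != j by apply: contraNneq nir => ->.
  by apply: (orthlP _ _ (ho i j ir _ ij)) => //; rewrite inE jr orbT.
split=> [|c|c x|c x].
- exact: orthl_cr.
- by rewrite supp_red ?orthl_red // suppX // sv.
- by rewrite init_conj_orthl // conjXg initX // iv.
- rewrite (orthl_comm o) invgM init_conj_orthl ?crV // ?orthlVl ?orthlV //.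
  by rewrite -expVgn conjXg initX // ivV.
Qed.

(** This is the passage from some point to all points: first letters of members are first letters of
    the product, so each member is cyclically reduced where the product is, and its length is the
    same at all such points. *)
Lemma orth_family_conj_prod (r : seq I) x : uniq r -> orth_family p r ->
  (forall i, i \in r -> (0 < m i)%N) ->
  red ((\prod_(i <- r) p i ^+ m i) ^ x) ((\prod_(i <- r) p i ^+ m i) ^ x) ->
  orth_family (fun i => p i ^ x) r.
Proof.
move=> ur fr hm /crP cv; have [_ _ iv ivV] := orth_family_prod ur fr hm.
apply: orth_family_conj => // i ir; rewrite cr_wlen //; first by case: fr => h _; apply: h.
apply/crP => c ic icV; apply: (cv c); first by rewrite iv; apply/hasP; exists i.
by rewrite -conjVg ivV; apply/hasP; exists i; rewrite // conjVg.
Qed.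

End FamilyProducts.

(** While [x] is not cyclically reduced, conjugation by one of its first letters [c] shortens it.
    Every other member [y] is fixed under conjugation by [x], which begins with [c], so
    [cr_fixable_first] keeps [y] cyclically reduced. *)
Lemma commuting_cr (s : seq G) :
  (forall x y, x \in s -> y \in s -> commute x y) ->
  exists a, forall x, x \in s -> red (x ^ a) (x ^ a).
Proof.
elim: s => [|x s IHs] hs; first by exists 1.
have [|a0 h0] := IHs; first by move=> y z ys zs; apply: hs; rewrite inE ?ys ?zs orbT.
suff [a [h ha]] : exists a, (forall y, y \in s -> red (y ^ a) (y ^ a)) /\ red (x ^ a) (x ^ a).
  by exists a => y; rewrite inE => /predU1P[->|/h].
have [n] := ubnP (l (x ^ a0)); elim: n => // n IHn in a0 h0 *; rewrite ltnS => lx.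
have [r|] := boolP (red (x ^ a0) (x ^ a0)); first by exists a0.
case/(redP _ _)/existsNP => c /not_implyP[iV] /not_implyP[i _].
have lc := letter_init i; apply: (IHn (a0 * c)); last first.
  by rewrite conjgM; have := wlen_conj_drop i iV; glia.
move=> y ys; rewrite conjgM; have cy := h0 y ys.
have cxy : commute (y ^ a0) (x ^ a0).
  by rewrite /commute -!conjMg; congr (_ ^ _); apply: hs; rewrite inE ?eqxx ?ys ?orbT.
have [] := @cr_conj_fixable c (y ^ a0) lc _ cy => //.
apply: cr_fixable_first i _ => //.
suff -> : (y ^ a0) ^ (x ^ a0) = y ^ a0 by [].
by rewrite {1}/conjg cxy mulKg.
Qed.

(** * Primitive elements *)

Lemma hull_zpowers v : zpowers v `<=` convex_closure S (zpowers v).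
Proof. exact: sub_smallest. Qed.

Lemma hull_convex v : convex S (convex_closure S (zpowers v)).
Proof.
move=> x y hx hy z hz A [cA sA]; apply: (cA x y) => //; first exact: hx.
exact: hy.
Qed.

Lemma hull_pre v g n : pre S g (v ^+ n) -> convex_closure S (zpowers v) g.
Proof.
move=> h; apply: (@hull_convex v 1 (v ^+ n)).
- by apply: hull_zpowers; exists 0%N; left.
- by apply: hull_zpowers; exists n; left.
- by rewrite /segment /= invg1 !mul1g.
Qed.

Lemma segment_pow v m n : red v v -> (m <= n)%N ->
  segment S (v ^- n) (v ^+ n) (v ^+ m) /\ segment S (v ^- n) (v ^+ n) (v ^- m).
Proof.
move=> cv mn; have [k ->] : exists k : nat, n = (m + k)%N by exists (n - m)%N; rewrite subnKC.
split; apply/segmentE; rewrite !invgK.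
  by rewrite (expgnDr v m k) mulKg -!expgnDr; apply: red_pow.
by rewrite addnC (expgnDr v k m) mulgK -!expgnDr; apply: red_pow.
Qed.

(** The segments from [v ^- n] to [v ^+ n] are convex and increase with [n], so their union is a
    convex set containing all powers. *)
Lemma hull_segment v g : red v v -> convex_closure S (zpowers v) g ->
  exists n, segment S (v ^- n) (v ^+ n) g.
Proof.
move=> cv; pose A := [set g | exists n, segment S (v ^- n) (v ^+ n) g].
suff: convex_closure S (zpowers v) `<=` A by apply.
have mono m n : (m <= n)%N -> segment S (v ^- m) (v ^+ m) `<=` segment S (v ^- n) (v ^+ n).
  by move=> mn; have [h1 h2] := segment_pow cv mn; apply: segment_convex.
apply: smallest_sub.
  move=> x y [m hx] [n hy] z hz; exists (maxn m n).
  by apply: (segment_convex (mono _ _ (leq_maxl m n) _ hx) (mono _ _ (leq_maxr m n) _ hy)).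
move=> x [n [->|->]]; exists n; first exact: segmentr.
exact: segmentl.
Qed.

Lemma cr_prefix v x n : red v v -> pre S x (v ^+ n) -> commute x v -> red x x.
Proof.
move=> cv; case: n => [|n] h cx.
  by move: h => /pre_len; rewrite expg0 wlen1 leqn0 wlen_eq0 => /eqP->; apply: red1.
case/preP: (h) => r er rr.
have cr : r * x = v ^+ n.+1.
  have -> : r = x^-1 * v ^+ n.+1 by rewrite er mulKg.
  by rewrite -mulgA -(commuteX n.+1 cx) mulKg.
have rr' : red r x.
  have := congr1 l cr; rewrite er (eqP rr) /red => ->; apply/eqP; lia.
apply/crP => c i iV; have iv : init c v.
  by rewrite -(cr_initX c cv (ltn0Sn n)) er init_redl.
have ivV : init c v^-1.
  rewrite -(cr_initX c (crV cv) (ltn0Sn n)) expVgn -cr invgM.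
  by apply: init_redl iV; apply: redV.
exact: (crP v cv c).
Qed.

Lemma pre_powX v x M (a : nat) : red v v -> pre S x (v ^+ M) -> commute x v ->
  pre S (x ^+ a) (v ^+ (M * a)).
Proof.
move=> cv h cx; have rx := cr_prefix cv h cx.
case/preP: (h) => r er rr; have cxr : commute x r.
  have -> : r = x^-1 * v ^+ M by rewrite er mulKg.
  by apply: commuteM; [apply/commuteV/commute_refl|apply: commuteX].
apply/preP; exists (r ^+ a); first by rewrite expgnA er expgMn.
have lr : (l (r ^+ a) <= a * l r)%N.
  elim: a => [|a IHa]; first by rewrite expg0 wlen1.
  by rewrite expgS; apply: leq_trans (wlen_le _ _) _; rewrite mulSn leq_add2l.
have := wlenX (M * a) cv; rewrite expgnA er expgMn // => e.
have le := wlen_le (x ^+ a) (r ^+ a); have ex := wlenX a rx.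
have ev := wlenX M cv; rewrite er (eqP rr) in ev.
apply/eqP; move: e le ex ev lr.
set n1 := l (x ^+ a * _); set n2 := l (x ^+ a); set n3 := l (r ^+ a).
move=> e le ex ev lr; have : n1 = (a * l x + a * l r)%N by rewrite e -mulnDr ev; lia.
lia.
Qed.

(** * Primitivity in terms of factorizations, roots and letter counts *)

Definition indecomposable v : Prop :=
  forall x y, v = x * y -> orthl x y -> x = 1 \/ y = 1.

Definition not_power v : Prop := forall x n, v = x ^+ n -> n = 1%N.

(** A factor or root of [v] commutes with [v] and lies below a power of it, so it is in [H_] and is
    a power of [v]. Supports exclude this for a proper factor, lengths for a proper root. *)
Lemma H_prim v : red v v -> v <> 1 -> H_ S v = zpowers v ->
  indecomposable v /\ not_power v.
Proof.
move=> cv v1 eH.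
have inH x : commute x v -> (exists n, pre S x (v ^+ n)) -> zpowers v x.
  by move=> cx [n h]; rewrite -eH; split=> //; apply: hull_pre h.
split=> [x y e o|x n e].
  have [||n hn] := inH x; first by rewrite /commute e -mulgA (orthl_comm o).
    by exists 1%N; rewrite expg1 e; apply/preM/orthl_red.
  have [y1|y1] := eqVneq y 1; [by right|left].
  case: n hn => [|n] hn; first by case: hn; rewrite expg0 ?invg1.
  have [c /init_supp sy] := init_ex y1.
  have sv : supp c v by rewrite e supp_red ?orthl_red // sy orbT.
  case: hn => ex.
    have sx : supp c x by rewrite ex suppX.
    by have := orthlP _ _ o c c sx sy; rewrite indep_irr.
  have sx : supp c^-1 x by rewrite ex suppV invgK suppX.
  by have := orthlP _ _ o _ _ sx sy; rewrite indepVl indep_irr.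
case: n e => [|n] e; first by case: v1; rewrite e.
have cx : red x x by apply: (cr_root (ltn0Sn n)); rewrite -e.
have [||k hk] := inH x.
- by rewrite e; apply: commuteX; apply: commute_refl.
- by exists 1%N; rewrite expg1 e -{1}(expg1 x); apply: pre_pow.
have lx : l x = (k * (n.+1 * l x))%N.
  case: hk => hk; rewrite {1}hk ?wlenV wlenX // {1}e wlenX //.
have l0 : (0 < l x)%N.
  by rewrite lt0n wlen_eq0; apply/eqP => x1; apply: v1; rewrite e x1 expg1n.
move/eqP: lx; rewrite mulnA -{1}(mul1n (l x)) eqn_pmul2r // eq_sym muln_eq1.
by case/andP => _ /eqP.
Qed.

Lemma split_supp (A : G -> bool) v :
  (forall d e, supp d v -> A d -> supp e v -> ~~ A e -> indep d e) ->
  exists x y, [/\ v = x * y, orthl x y, forall c, supp c x -> A c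
    & forall c, supp c y -> ~~ A c].
Proof.
elim/len_ind: v => [|c v lc n IHv] h.
  by exists 1, 1; rewrite mulg1 orthl1; split=> // c; rewrite supp1.
have [|x [y [e o hx hy]]] := IHv.
  by move=> d e sd Ad se Ae; apply: h => //; rewrite supp_cons // ?sd ?se orbT.
have r := orthl_red o; rewrite e in h n *.
have sc : supp c (c * (x * y)) by rewrite supp_cons ?eqxx.
have sx d : supp d x -> supp d (c * (x * y)).
  by move=> s; rewrite supp_cons // supp_red // s !orbT.
have sy d : supp d y -> supp d (c * (x * y)).
  by move=> s; rewrite supp_cons // supp_red // s !orbT.
have [Ac|nAc] := boolP (A c).
  have nx : ~~ init c^-1 x by apply: contraNN n; apply: init_redl.
  exists (c * x), y; split=> // [||d]; first by rewrite mulgA.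
    apply/orthlP => d f; rewrite supp_cons // => /orP[/eqP<-|sd] sf.
      by apply: h => //; [apply: sy|apply: hy].
    exact: (orthlP _ _ o).
  by rewrite supp_cons // => /orP[/eqP<-|/hx].
have cx : perp c x.
  by apply/perpP => d sd; rewrite indepC; apply: h => //; [apply: sx|apply: hx].
have ny : ~~ init c^-1 y by apply: contraNN n; rewrite perp_init ?perpVl.
exists x, (c * y); split=> // [||d].
- by rewrite mulgA (perp_comm cx) mulgA.
- apply/orthlP => d f sd; rewrite supp_cons // => /orP[/eqP<-|sf].
    by rewrite indepC; apply: (perpP _ _ cx).
  exact: (orthlP _ _ o).
- by rewrite supp_cons // => /orP[/eqP<-|/hy].
Qed.

(* If the two ratios of letter counts differed, suitable powers of [x] and [v]
   lying below a common power of [v] would compare in opposite ways on [d] and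
   [e], which forces these letters to commute. *)
Lemma cnt_ratio v x M d e : red v v -> pre S x (v ^+ M) -> commute x v ->
  ~~ indep d e -> (cnt d x * cnt e v <= cnt e x * cnt d v)%N.
Proof.
move=> cv h cx nde; have rx := cr_prefix cv h cx; rewrite leqNgt; apply/negP => lt.
(* The quotient of [b] by [a] is the mediant of the ratios of counts in [x] to counts in [v] for [d]
   and [e], so it separates them; both inequalities below reduce to [lt]. *)
pose a := (cnt d v + cnt e v)%N; pose b := (cnt d x + cnt e x)%N.
have h1 : pre S (x ^+ a) (v ^+ maxn (M * a) b).
  by apply: pre_trans (pre_powX a cv h cx) _; apply: pre_pow; rewrite // leq_maxl.
have h2 : pre S (v ^+ b) (v ^+ maxn (M * a) b) by apply: pre_pow; rewrite // leq_maxr.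
move/negP: nde; apply; apply: (cnt_indep h1 h2); rewrite !cntX //.
  rewrite /a /b; nia.
rewrite /a /b; nia.
Qed.

(** With coprime exponents, Bezout coefficients write [v] as a power with exponent [a1], which
    forces [a1 = 1]. *)
Lemma power_root x v (a b : nat) : (0 < a)%N -> x ^+ a = v ^+ b -> commute x v ->
  not_power v -> exists n, x = v ^+ n.
Proof.
move=> a0 e cx np; case: b e => [|b] e.
  by exists 0%N; apply: (root_inj a0); rewrite e !expg0 expg1n.
set d := gcdn a b.+1; have d0 : (0 < d)%N by rewrite gcdn_gt0 a0.
have [a1 ea] : exists a1 : nat, a = (a1 * d)%N by exists (a %/ d)%N; rewrite divnK // dvdn_gcdl.
have [b1 eb] : exists b1 : nat, b.+1 = (b1 * d)%N by exists (b.+1 %/ d)%N; rewrite divnK // dvdn_gcdr.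
have {}e : x ^+ a1 = v ^+ b1.
  by apply: (root_inj d0); rewrite -!expgnA -ea -eb.
have a10 : (0 < a1)%N by case: (a1) ea a0 => // ->.
have gab : gcdn a1 b1 = 1%N.
  have := erefl d; rewrite {1}/d ea eb -muln_gcdl -{2}(mul1n d) => /eqP.
  by rewrite eqn_pmul2r // => /eqP.
case: (egcdnP b1 a10) => k j ekj _; rewrite gab in ekj.
have : v = (v ^+ k * x ^- j) ^+ a1.
  have cvx : commute (v ^+ k) (x ^+ j) by apply: commuteX2; apply: commute_sym.
  rewrite expgMn; last exact: commuteV.
  rewrite expVgn -!expgnA (mulnC j) (expgnA x) e -expgnA ekj.
  by rewrite (mulnC j) addn1 expgS mulgK.
by move=> /np a11; exists b1; rewrite -e a11.
Qed.

(** By [cnt_ratio], dependent letters of [v] have equal ratios of counts, so the letters sharing the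
    ratio of [c] form an orthogonal factor, which is all of [v]. Hence a power of [x] has the letter
    counts of a power of [v], and [cnt_inj] identifies them. *)
Lemma commuting_prefix v x M : red v v -> v <> 1 -> indecomposable v ->
  not_power v -> pre S x (v ^+ M) -> commute x v -> exists n, x = v ^+ n.
Proof.
move=> cv /eqP v1 iv np h cx; have rx := cr_prefix cv h cx.
have [c /init_supp sc] := init_ex v1.
pose A d := (cnt c x * cnt d v == cnt d x * cnt c v)%N.
have [|y [z [e o hy hz]]] := @split_supp A v.
  move=> d f sd Ad sf Af; apply/negPn/negP => ndf.
  have r1 := cnt_ratio cv h cx ndf; rewrite indepC in ndf.
  have r2 := cnt_ratio cv h cx ndf.
  move/eqP: Ad => Ad; move/eqP: Af; apply.
  apply/eqP; rewrite -(eqn_pmul2r sd); apply/eqP.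
  rewrite mulnAC Ad mulnAC [RHS]mulnAC; congr (_ * _)%N; apply/eqP.
  by rewrite eqn_leq r1 r2.
have z1 : z = 1.
  case: (iv _ _ e o) => // y1; rewrite y1 mul1g in e.
  by have := hz c; rewrite -e => /(_ sc); rewrite /A eqxx.
have vA d : A d.
  have [sd|nsd] := boolP (supp d v); first by apply: hy; rewrite e z1 mulg1 in sd.
  have v0 : cnt d v = 0%N by move: nsd; rewrite /supp -eqn0Ngt => /eqP.
  have : cnt d x = 0%N.
    by case/preP: h => r er rr; have := cntX d M cv; rewrite er cnt_red // v0; lia.
  by rewrite /A v0 => ->; rewrite muln0.
have : x ^+ cnt c v = v ^+ cnt c x.
  have h1 := pre_powX (cnt c v) cv h cx.
  set K := maxn (M * cnt c v) (cnt c x).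
  apply: (@cnt_inj _ _ (v ^+ K)).
  - by apply: pre_trans h1 _; apply: pre_pow; rewrite // leq_maxl.
  - by apply: pre_pow; rewrite // leq_maxr.
  by move=> d; rewrite !cntX //; have /eqP := vA d; lia.
by move/power_root; apply.
Qed.

Lemma prim_H v : red v v -> v <> 1 -> indecomposable v -> not_power v ->
  H_ S v = zpowers v.
Proof.
move=> cv v1 iv np; apply/seteqP; split=> [g [cg /(hull_segment cv)[n]]|g hg].
  (* Translation by [v ^+ n] makes the segment start at 1, so that its elements are prefixes of a
     power. *)
  move=> /(segmentM (v ^+ n)); rewrite mulgV -expgnDr => h.
  have h' : pre S (v ^+ n * g) (v ^+ (n + n)) by move: h; rewrite /segment /= invg1 !mul1g.
  have cvg : commute (v ^+ n * g) v.
    by apply/commute_sym/commuteM; [apply/commuteX/commute_refl|apply: commute_sym].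
  have [k ek] := commuting_prefix cv v1 iv np h' cvg.
  have {ek} -> : g = v ^- n * v ^+ k by rewrite -ek mulKg.
  have [nk|kn] := leqP n k.
    by exists (k - n)%N; left; rewrite -{1}(subnKC nk) expgnDr mulKg.
  exists (n - k)%N; right; rewrite -{1}(subnKC (ltnW kn)) expgnDr invgM.
  by rewrite mulgVK.
split; last exact: hull_zpowers.
by case: hg => n [->|->]; apply/commute_sym; [|apply: commuteV]; apply/commuteX/commute_refl.
Qed.

Definition cr_prim v : Prop :=
  [/\ red v v, v <> 1, indecomposable v & not_power v].

Lemma orthl_crr x y : orthl x y -> red (x * y) (x * y) -> red y y.
Proof. by move=> o; rewrite (orthl_comm o); apply: orthl_crl; rewrite orthlC. Qed.

Lemma cr_prim_conj v x : cr_prim v -> red (v ^ x) (v ^ x) -> cr_prim (v ^ x).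
Proof.
move=> [cv v1 iv np] cvx; split=> //.
- by move/eqP; rewrite conjg_eq1 => /eqP.
- move=> y z e o; have cy : red y y by apply: (orthl_crl o); rewrite -e.
  have cz : red z z by apply: (orthl_crr o); rewrite -e.
  pose P (b : bool) := if b then y else z.
  have fP : orth_family P [:: true; false].
    split=> [[]//|[] [] // _ _ _ /=]; by [exact: o|rewrite orthlC].
  have ev : \prod_(b <- [:: true; false]) P b ^+ 1 = v ^ x.
    by rewrite !big_cons big_nil mulg1 !expg1 /= -e.
  have := @orth_family_conj_prod _ P (fun=> 1%N) [:: true; false] x^-1 isT fP (fun _ _ => isT).
  rewrite ev conjgK => /(_ cv) [_ /(_ true false isT isT isT) o'].
  have [] := iv (y ^ x^-1) (z ^ x^-1) _ o'; first by rewrite -conjMg -e conjgK.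
    by move/eqP; rewrite conjg_eq1 => /eqP; left.
  by move/eqP; rewrite conjg_eq1 => /eqP; right.
- by move=> u n e; apply: (np (u ^ x^-1)); rewrite -conjXg -e conjgK.
Qed.

Lemma primitiveP w a : red (w ^ a) (w ^ a) -> primitive S w <-> cr_prim (w ^ a).
Proof.
move=> ca; split=> [[w1 [b /X_P cb /H_prim hb]]|[_ v1 iv np]]; last first.
  split; first by move=> e; apply: v1; rewrite e conj1g.
  by exists a; [apply/X_P|apply: prim_H].
have v1 : w ^ b <> 1 by move/eqP; rewrite conjg_eq1 => /eqP.
have [iv np] := hb cb v1.
by rewrite -(mulVKg b a) conjgM; apply: cr_prim_conj; rewrite // -conjgM mulVKg.
Qed.

(** * Existence of primitive decompositions *)

Lemma power_ex v : red v v -> v <> 1 -> exists u n, [/\ v = u ^+ n, (0 < n)%N & not_power u].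
Proof.
have [k] := ubnP (l v); elim: k => // k IHk in v *; rewrite ltnS => lv cv v1.
have [np|] := pselect (not_power v); first by exists v, 1%N.
case/existsNP => x /existsNP[n] /not_implyP[e n1].
have n2 : (1 < n)%N by case: n e n1 => [|[]].
have cx : red x x by apply: (cr_root (ltnW n2)); rewrite -e.
have x1 : x <> 1 by move=> x1; apply: v1; rewrite e x1 expg1n.
have l0 : (0 < l x)%N by rewrite lt0n wlen_eq0; apply/eqP.
have lx := wlenX n cx; rewrite -e in lx.
have [|u [j [eu j0 np]]] := IHk x _ cx x1.
  by apply: leq_trans lv; rewrite lx ltn_Pmull.
by exists u, (j * n)%N; rewrite expgnA -eu muln_gt0 j0 ltnW.
Qed.

(** Orthogonal factors are split off as long as possible. An indecomposable element is a power of
    some [u] that is no proper power, and [u] is indecomposable because a factorization of [u] gives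
    one of its powers. *)
Lemma cr_decomp v : red v v -> exists s : seq (G * nat),
  [/\ v = \prod_(f <- s) f.1 ^+ f.2,
      forall f, f \in s -> cr_prim f.1 /\ (0 < f.2)%N,
      forall f c, f \in s -> supp c f.1 -> supp c v
    & pairwise (fun f f' => orthl f.1 f'.1) s].
Proof.
have [k] := ubnP (l v); elim: k => // k IHk in v *; rewrite ltnS => lv cv.
have [v1|/eqP v1] := eqVneq v 1; first by exists [::]; rewrite big_nil.
have [iv|] := pselect (indecomposable v).
  have [u [n [e n0 np]]] := power_ex cv v1.
  have cu : red u u by apply: (cr_root n0); rewrite -e.
  exists [:: (u, n)]; rewrite big_seq1; split=> // [a|a c]; rewrite inE => /eqP->; last first.
    by rewrite e suppX.
  split=> //; split=> //=; first by move=> u1; apply: v1; rewrite e u1 expg1n.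
  move=> x y exy o; have cx : red x x by apply: (orthl_crl o); rewrite -exy.
  have cy : red y y by apply: (orthl_crr o); rewrite -exy.
  have [||xn|yn] := iv (x ^+ n) (y ^+ n).
  - by rewrite e exy expgMn //; apply: orthl_comm.
  - by apply: orthl_supp o => c; apply: supp_expg.
  - by left; apply: (root_inj n0); rewrite xn expg1n.
  by right; apply: (root_inj n0); rewrite yn expg1n.
case/existsNP => x /existsNP[y] /not_implyP[e] /not_implyP[o] /not_orP[x1 y1].
have cx : red x x by apply: (orthl_crl o); rewrite -e.
have cy : red y y by apply: (orthl_crr o); rewrite -e.
have lx : (0 < l x)%N by rewrite lt0n wlen_eq0; apply/eqP.
have ly : (0 < l y)%N by rewrite lt0n wlen_eq0; apply/eqP.
have lxy := eqP (orthl_red o); rewrite -e in lxy.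
have [|sx [ex px ssx wx]] := IHk x _ cx; first by glia.
have [|sy [ey py ssy wy]] := IHk y _ cy; first by glia.
have svx c : supp c x -> supp c v by move=> s; rewrite e supp_red ?orthl_red ?s.
have svy c : supp c y -> supp c v by move=> s; rewrite e supp_red ?orthl_red ?s ?orbT.
exists (sx ++ sy); split.
- by rewrite big_cat /= -ex -ey.
- by move=> a; rewrite mem_cat => /orP[/px|/py].
- by move=> a c; rewrite mem_cat => /orP[/ssx h /h/svx|/ssy h /h/svy].
rewrite pairwise_cat wx wy !andbT; apply/allrelP => a b ax by_.
by apply: orthl_supp o => c; [apply: ssx|apply: ssy].
Qed.

(** [prim_decomp] does not record that the factors are cyclically reduced where the product is; this
    is recovered here. *)
Lemma orth_prod_cr (I : eqType) (P : I -> G) (m : I -> nat) (r : seq I) :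
  uniq r -> (forall i, i \in r -> (0 < m i)%N) ->
  (forall i j, i \in r -> j \in r -> i != j -> orthl (P i) (P j)) ->
  red (\prod_(i <- r) P i ^+ m i) (\prod_(i <- r) P i ^+ m i) ->
  orth_family P r.
Proof.
move=> ur hm ho hv; split=> //; elim: r ur hm ho hv => [//|i r IHr] /= /andP[nir ur] hm ho.
have ir : i \in i :: r by rewrite inE eqxx.
rewrite big_cons => hv.
have o : orthl (P i ^+ m i) (\prod_(j <- r) P j ^+ m j).
  have : {subset r <= r} by [].
  elim: {1 3}r => [|j r' IHr'] sr; first by rewrite big_nil orthl1.
  rewrite big_cons; apply: orthl_mulr; last by apply: IHr' => k kr; apply: sr; rewrite inE kr orbT.
  have jr : j \in r by apply: sr; rewrite inE eqxx.
  have ij : i != j by apply: contraNneq nir => ->.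
  by apply: orthl_supp (ho i j ir _ ij) => [c|c|]; rewrite ?inE ?jr ?orbT //; apply: supp_expg.
move=> j; rewrite inE => /predU1P[->|jr].
  by apply: (cr_root (hm i ir)); apply: (orthl_crl o).
apply: IHr => // [k kr|k k' kr kr'|].
- by apply: hm; rewrite inE kr orbT.
- by apply: ho; rewrite inE ?kr ?kr' orbT.
- exact: orthl_crr o hv.
Qed.

Section Decompositions.
Variables (w : G) (n : nat) (p : 'I_n -> G) (m : 'I_n -> nat).
Local Notation E := (index_enum 'I_n).

Lemma prim_decomp_conj a : prim_decomp S w p m ->
  w ^ a = \prod_(i < n) (p i ^ a) ^+ m i.
Proof.
by case=> e _ _ _; rewrite {1}e conjg_prod; apply: eq_bigr => i _; rewrite conjXg.
Qed.

Lemma prim_decomp_family a : prim_decomp S w p m -> red (w ^ a) (w ^ a) ->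
  orth_family (fun i => p i ^ a) E.
Proof.
move=> h ca; have e := prim_decomp_conj a h; case: h => _ _ hm ho.
apply: (@orth_prod_cr _ _ m); rewrite ?index_enum_uniq -?e //.
by move=> i j _ _ /eqP ij; apply/orthogonalP; apply: ho => //; apply/X_P.
Qed.

Lemma prim_decomp_init c y : prim_decomp S w p m ->
  init c (w ^ y) <-> exists i, init c (p i ^ y).
Proof.
move=> h; have [a ca] := cr_ex w; have f := prim_decomp_family h ca.
have hm i : i \in E -> (0 < m i)%N by case: h => _ _ hm _ _; apply: hm.
have [_ _ iv _] := orth_family_prod (index_enum_uniq _) f hm.
have := iv c (a^-1 * y); rewrite -(prim_decomp_conj a h) -conjgM mulVKg => ->.
split=> [/hasP[i _]|[i ii]]; first by rewrite -conjgM mulVKg; exists i.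
by apply/hasP; exists i; rewrite ?mem_index_enum // -conjgM mulVKg.
Qed.

(** Orthogonality at the single point [a] suffices, by [orth_family_conj_prod]. *)
Lemma prim_decomp_intro a : (forall i, primitive S (p i)) ->
  (forall i, (1 <= m i)%N) -> w = \prod_(i < n) p i ^+ m i ->
  orth_family (fun i => p i ^ a) E -> prim_decomp S w p m.
Proof.
move=> hp hm e f; split=> // i j b ij /X_P cb; apply/orthogonalP.
have ea : \prod_(i < n) (p i ^ a) ^+ m i = w ^ a.
  by rewrite {1}e conjg_prod; apply: eq_bigr => k _; rewrite conjXg.
have := @orth_family_conj_prod _ (fun i => p i ^ a) m E (a^-1 * b) (index_enum_uniq _) f
  (fun i _ => hm i).
rewrite ea -conjgM mulVKg => /(_ cb) [_ /(_ i j)].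
by rewrite -!conjgM mulVKg; apply; rewrite ?mem_index_enum //; apply/eqP.
Qed.

End Decompositions.

Lemma prim_decomp_ex w : exists n (p : 'I_n -> G) (m : 'I_n -> nat), prim_decomp S w p m.
Proof.
have [a ca] := cr_ex w; have [s [e ps _ ws]] := cr_decomp ca.
pose t := in_tuple s; exists (size s), (fun i => (tnth t i).1 ^ a^-1), (fun i => (tnth t i).2).
have ts i : tnth t i \in s by apply: mem_tnth.
apply: (@prim_decomp_intro _ _ _ _ a).
- move=> i; have [h _] := ps _ (ts i); have h' := h; rewrite -(conjgKV a (tnth t i).1) in h'.
  by apply/(@primitiveP _ a) => //; case: h'.
- by move=> i; have [] := ps _ (ts i).
- rewrite -[w in LHS](conjgK a) e big_tnth conjg_prod; apply: eq_bigr => i _.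
  by rewrite conjXg.
split=> [i _|i j _ _ ij]; rewrite !conjgKV; first by have [[]] := ps _ (ts i).
have nthE (o : 'I_(size s)) : tnth t o = nth (1, 0%N) s o by apply: tnth_nth.
move/(pairwiseP (1, 0%N)): ws => ws.
have [ltij|ltji|eij] := ltngtP i j.
- by rewrite !nthE; apply: ws; rewrite ?inE.
- by rewrite orthlC !nthE; apply: ws; rewrite ?inE.
by move: ij; rewrite (val_inj eij) eqxx.
Qed.

(** * Comparison of quasidirections *)

(* The value 1 of [z] is left out because of the default value in [quasidir]. *)
Definition init_dominated q w : Prop :=
  forall z c, z != 1 -> init c (q ^ z) -> init c (w ^ z).

(** Each step from [y] along [u] conjugates [w] by one of its first letters. The bound on [l u]
    keeps the walk away from 1, where domination says nothing. The last clause spends one copy of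
    [w ^ y] per letter of [u]. *)
Lemma init_path q w u y : init_dominated q w -> (l u < l y)%N ->
  red (q ^ y) (q ^ y) -> pre S u (q ^ y) ->
  [/\ (l (w ^ (y * u)) <= l (w ^ y))%N,
      l (w ^ (y * u)) = l (w ^ y) -> forall c, supp c (w ^ (y * u)) = supp c (w ^ y)
    & red (w ^ y) (w ^ y) -> pre S u ((w ^ y) ^+ l u)].
Proof.
move=> D; elim/len_ind: u y => [|c u lc n IHu] y.
  by rewrite mulg1 => _ _ _; split=> // _; apply: pre1.
move=> lu cq puq; have rcu : red c u by rewrite red_consP.
have eu := wlenM lc n.
have iq : init c (q ^ y) by apply: pre_init puq _; apply: initV.
have y1 : y != 1 by rewrite -wlen_eq0 -lt0n; apply: leq_ltn_trans lu.
have iw := D _ _ y1 iq.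
have [rqc eqc _] := cr_conj_init iq cq; rewrite -conjgM in rqc eqc.
have [nq elq] := initK iq; have [nw elw] := initK iw.
have rot g : init c g -> l (g ^ c) = l g -> red (c^-1 * g) c.
  move=> i e; have [_ e'] := initK i; by rewrite /red -mulgA -/(conjg g c) e e' (wlen_letter lc) addn1.
have lyc : (l u < l (y * c))%N.
  have := wlen_le (y * c) c^-1; rewrite mulgK wlenV (wlen_letter lc) => h.
  by rewrite eu in lu; glia.
have puqc : pre S u (q ^ (y * c)).
  have r : red (c^-1 * q ^ y) c by apply: rot => //; rewrite -conjgM.
  have -> : q ^ (y * c) = c^-1 * q ^ y * c by rewrite conjgM /conjg !mulgA.
  apply: pre_trans (preM r); apply/(pre_redl rcu); first by rewrite red_consP.
  by rewrite mulVKg.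
have [h1 h2 h3] := IHu _ lyc rqc puqc.
have lec := wlen_conj_init iw; rewrite -conjgM in lec.
rewrite mulgA; split; first exact: leq_trans lec.
  move=> e; have e' : l (w ^ (y * c)) = l (w ^ y) by apply/eqP; rewrite eqn_leq lec -e h1.
  move=> d; rewrite h2 ?e ?e' // conjgM supp_conj_init // -conjgM //.
move=> cw; have [rwc ewc _] := cr_conj_init iw cw.
have := h3; rewrite conjgM => /(_ rwc) {}h3; rewrite eu.
set W := w ^ y in cw rwc ewc h3 iw nw elw *; set j := l u in h3 *.
(* One copy of [W] supplies [c]; the remaining [j] copies, rotated by [c], supply [u] by
   induction. *)
have eW : W ^+ j.+1 = c * ((W ^ c) ^+ j * (c^-1 * W)).
  by rewrite -conjXg expgSr /conjg !gnorm.
have lWj := wlenX j.+1 cw; have lWcj := wlenX j rwc; rewrite ewc in lWcj.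
have t1 := wlen_le c ((W ^ c) ^+ j * (c^-1 * W)).
have t2 := wlen_le ((W ^ c) ^+ j) (c^-1 * W).
have lc1 := wlen_letter lc; rewrite -eW lWj mulSn in t1.
have r1 : red ((W ^ c) ^+ j) (c^-1 * W) by apply/eqP; glia.
have r2 : red c ((W ^ c) ^+ j * (c^-1 * W)).
  by apply/eqP; rewrite -eW lWj mulSn; glia.
rewrite eW; apply/pre_redl => //; apply: pre_trans h3 _; exact: preM.
Qed.

Lemma bounded_repeat (f : nat -> G) (s : seq G) K : (forall n, l (f n) = K) ->
  (forall n c, supp c (f n) -> c \in s) -> exists i j, (i < j)%N /\ f i = f j.
Proof.
move=> fK fs.
pose code n := [seq inord (index (lval f) s) : 'I_(size s).+1 | f <- rword (f n)].
have sz n : size (code n) == K by rewrite size_map -wlenE fK.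
have hF n : \prod_(o <- code n) nth 1 s o = f n.
  have [_ _ <-] := rwordP (f n).
  rewrite /code big_map /word_val big_seq [RHS]big_seq; apply: eq_bigr => a' ar.
  have as_ : lval a' \in s.
    by apply: (fs n); rewrite /supp /cnt -has_count; apply/hasP; exists a'.
  by rewrite inordK ?nth_index // ltnS index_size.
pose F n : K.-tuple 'I_(size s).+1 := Tuple (sz n).
have FE n n' : F n = F n' -> f n = f n' by move=> /(congr1 val) /= e; rewrite -!hF e.
have : ~~ injectiveb (fun i : 'I_(#|{: K.-tuple 'I_(size s).+1}|.+1) => F i).
  apply/negP => /injectiveP /leq_card; rewrite card_ord => h.
  by rewrite ltnn in h.
case/injectivePn => i [j ij /FE e]; have : (i < j)%N || (j < i)%N.
  by rewrite -neq_ltn; apply: contraNneq ij => /val_inj->.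
by case/orP => lt; [exists i, j|exists j, i].
Qed.

Lemma eventually_const (f : nat -> nat) : (forall n, (f n.+1 <= f n)%N) ->
  exists N, forall n, f (N + n)%N = f N.
Proof.
move=> hf; have mono i j : (f (i + j) <= f i)%N.
  by elim: j => [|j IHj]; rewrite ?addn0 // addnS (leq_trans (hf _)).
have h (b n : nat) : (f n < b)%N -> exists N, forall n, f (N + n)%N = f N.
  elim: b n => // b IHb n; rewrite ltnS => fn.
  have [[j lt]|no] := pselect (exists j : nat, (f (n + j) < f n)%N).
    by apply: (IHb (n + j)%N); apply: leq_trans fn.
  exists n => j; apply/eqP; rewrite eqn_leq mono leqNgt /=.
  by apply/negP => lt; apply: no; exists j.
exact: (h (f 0%N).+1 0%N).
Qed.

(* Along the axis of [q] the conjugates of [w] never get longer, so eventually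
   they are only cyclically permuted and two of them coincide: a power of [q]
   commutes with a conjugate of [w]. *)
Lemma dominated_commute q w y : init_dominated q w -> q != 1 ->
  red (q ^ y) (q ^ y) -> commute w q.
Proof.
move=> D q1 cq; set Q := q ^ y in cq *.
have Q1 : (0 < l Q)%N by rewrite lt0n wlen_eq0 conjg_eq1.
have qy n : q ^ (y * Q ^+ n) = Q.
  rewrite conjgM -/Q; have h : commute Q (Q ^+ n) by apply/commuteX/commute_refl.
  by rewrite {1}/conjg h mulKg.
(* The offset makes up for [l y] and leaves two periods, so that every point used is farther from 1
   than [l Q]. *)
pose n0 := (l y + 2)%N; pose W n := w ^ (y * Q ^+ (n0 + n)).
have far n : (l Q < l (y * Q ^+ (n0 + n)))%N.
  have := wlen_le y^-1 (y * Q ^+ (n0 + n)); rewrite mulKg wlenX // wlenV /n0 => h.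
  have : ((l y + 2 + n) * l Q >= l y + 2 * l Q)%N by nia.
  by glia.
have W_succ n : (W n ^ Q) = W n.+1 by rewrite /W -conjgM -mulgA -expgSr addnS.
have step n : (l (W n.+1) <= l (W n))%N /\
    (l (W n.+1) = l (W n) -> forall c, supp c (W n.+1) = supp c (W n)).
  have [||h1 h2 _] := @init_path q w Q (y * Q ^+ (n0 + n)) D (far n).
  - by rewrite qy.
  - by rewrite qy; apply: pre_refl.
  by rewrite -W_succ /W -conjgM.
have [N hN] := @eventually_const (fun n => l (W n)) (fun n => (step n).1).
(* Constant length gives constant support, so a finite alphabet suffices for the pigeonhole
   argument. *)
have hs n c : supp c (W (N + n)%N) = supp c (W N).
  elim: n => [|n IHn]; first by rewrite addn0.
  by rewrite addnS (proj2 (step _)) // -addnS !hN.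
have [||i [j [ij e]]] := @bounded_repeat (fun n => W (N + n)%N)
    [seq lval f | f <- rword (W N)] (l (W N)).
- by move=> n; rewrite hN.
- by move=> n c; rewrite hs /supp /cnt -has_count => /hasP[f fr /eqP <-]; apply: map_f.
have WX n (d : nat) : W (n + d)%N = W n ^ (Q ^+ d).
  elim: d => [|d IHd]; first by rewrite addn0 expg0 conjg1.
  by rewrite addnS -W_succ IHd -conjgM -expgSr.
have := e; rewrite -(subnKC (ltnW ij)) addnA (WX (N + i)%N) => {}e.
have cWQ : commute (W (N + i)%N) Q.
  apply: (@commute_root _ _ (j - i)); first by rewrite subn_gt0.
  by rewrite /commute [LHS]conjgC -e.
apply: (@conjg_inj _ (y * Q ^+ (n0 + (N + i)))).
by move: cWQ; rewrite /commute !conjMg qy.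
Qed.

Lemma pre_orthl_mul q x y : orthl x y -> orthl q y -> pre S q (x * y) -> pre S q x.
Proof.
elim/len_ind: q x => [|c q lc n IHq] x o oq h; first exact: pre1.
have rcq : red c q by rewrite red_consP.
have sc : supp c (c * q) by rewrite supp_cons ?eqxx.
have : init c (x * y) by apply: pre_init h _; apply: initV.
rewrite orthl_init // => /orP[ix|/init_supp sy]; last first.
  by have := orthlP _ _ oq _ _ sc sy; rewrite indep_irr.
have [nx _] := initK ix; have rx : red c (c^-1 * x) by rewrite red_consP.
have ox : orthl (c^-1 * x) y.
  by apply: orthl_supp o => // d sd; rewrite -(mulVKg c x) supp_cons // sd orbT.
rewrite -(mulVKg c x); apply/(pre_redl rcq rx); apply: IHq => //.
  by apply: orthl_supp oq => // d sd; rewrite supp_cons // sd orbT.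
have rxy : red c (c^-1 * x * y).
  by have := orthl_red o; rewrite -{1}(mulVKg c x) redA // => /andP[].
by apply/(pre_redl rcq rxy); rewrite mulgA mulVKg.
Qed.

Lemma orth_family_extract (I : eqType) (P : I -> G) (m : I -> nat) (r : seq I) i :
  uniq r -> orth_family P r -> i \in r -> exists2 z,
  \prod_(j <- r) P j ^+ m j = P i ^+ m i * z & orthl (P i) z.
Proof.
elim: r => [//|j r IHr] /= /andP[njr ur] [hc ho]; rewrite inE big_cons.
have [ -> _|nij /= ir] := eqVneq i j.
  exists (\prod_(k <- r) P k ^+ m k) => //.
  have : {subset r <= r} by [].
  elim: {1 3}r => [|k r' IHr'] sr; first by rewrite big_nil orthl1.
  have kr : k \in r by apply: sr; rewrite inE eqxx.
  have jk : j != k by apply: contraNneq njr => ->.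
  rewrite big_cons; apply: orthl_mulr; last by apply: IHr' => k' k'r; apply: sr; rewrite inE k'r orbT.
  by apply: orthl_supp (ho j k _ _ jk) => [c|c||]; rewrite ?inE ?eqxx ?kr ?orbT //; apply: supp_expg.
have [|z -> o] := IHr ur _ ir.
  by split=> [k kr|k k' kr kr']; [apply: hc|apply: ho]; rewrite inE ?kr ?kr' orbT.
have oij : orthl (P i) (P j ^+ m j).
  have oij := ho i j _ _ nij; rewrite !inE eqxx ir orbT in oij.
  by apply: orthl_supp (oij isT isT) => // c; apply: supp_expg.
exists (P j ^+ m j * z); last exact: orthl_mulr.
rewrite !mulgA; congr (_ * _); apply/esym/orthl_comm.
by apply: orthl_supp oij => // c; apply: supp_expg.
Qed.

Lemma dominated_factor q w n (p : 'I_n -> G) (m : 'I_n -> nat) :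
  primitive S q -> prim_decomp S w p m -> init_dominated q w -> exists i, q = p i.
Proof.
move=> pq h D; have [y cy] := cr_ex q; have q1 : q != 1 by case: pq => /eqP.
have cwq := dominated_commute D q1 cy.
have [|a ha] := @commuting_cr [:: q; w].
  move=> x z; rewrite !inE => /orP[]/eqP-> /orP[]/eqP->; by [|apply: commute_sym].
have cq : red (q ^ a) (q ^ a) by apply: ha; rewrite inE eqxx.
have cw : red (w ^ a) (w ^ a) by apply: ha; rewrite !inE eqxx orbT.
have [_ Q1 iQ npQ] := (primitiveP cq).1 pq.
set Q := q ^ a in cq Q1 iQ npQ *; set W := w ^ a in cw *.
have cWQ : commute W Q by rewrite /commute -!conjMg cwq.
have Q0 : (0 < l Q)%N by rewrite lt0n wlen_eq0; apply/eqP.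
(* Going far along the axis leaves [q ^ a] and [w ^ a] unchanged, since both commute with [Q], and
   reaches a point where [init_path] applies. *)
pose b := a * Q ^+ (l a + 2).
have eqb : q ^ b = Q.
  have hQ : commute Q (Q ^+ (l a + 2)) by apply/commuteX/commute_refl.
  by rewrite conjgM -/Q {1}/conjg hQ mulKg.
have ewb : w ^ b = W.
  have hQ : commute W (Q ^+ (l a + 2)) by apply/commuteX.
  by rewrite conjgM -/W {1}/conjg hQ mulKg.
have lb : (l Q < l b)%N.
  have := wlen_le a^-1 b; rewrite mulKg wlenX // wlenV => hb.
  have : ((l a + 2) * l Q >= l a + 2 * l Q)%N by nia.
  by glia.
have [||_ _] := init_path D lb; rewrite ?eqb ?ewb //; first exact: pre_refl.
move=> /(_ cw); set K := l Q => hQ.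
have K0 : (0 < K)%N by [].
have f := prim_decomp_family h cw; have e := prim_decomp_conj a h; rewrite -/W in e.
have hm i : i \in index_enum 'I_n -> (0 < m i)%N by case: h => _ _ hm _ _; apply: hm.
have [_ sW _ _] := orth_family_prod (index_enum_uniq _) f hm; rewrite -e in sW.
have sQ c : supp c Q -> has (fun i => supp c (p i ^ a)) (index_enum 'I_n).
  by move=> sc; rewrite -sW -(suppX c cw K0); apply: pre_supp hQ sc.
have [c ic] := init_ex (introN eqP Q1); have sc := init_supp ic.
have /hasP[i iE sci] := sQ c sc; set P := p i ^ a in sci.
(* Letters of [Q] outside the support of [P] come from other members of the family, so they are
   independent of those inside; indecomposability of [Q] leaves only the latter. *)
have [|x [z [exz o hx hz]]] := @split_supp (fun d => supp d P) Q.
  move=> d d' sd Ad sd' Ad'; have /hasP[j jE sj] := sQ d' sd'.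
  have ij : i != j by apply: contraNneq Ad' => ij; rewrite /P ij.
  by case: f => _ ho; apply: (orthlP _ _ (ho i j iE jE ij)).
have z1 : z = 1.
  case: (iQ _ _ exz o) => // x1; rewrite x1 mul1g in exz.
  by move: (hz c); rewrite -exz sci => /(_ sc).
rewrite z1 mulg1 in exz; rewrite -exz in hx.
have [z' ez' oz'] := orth_family_extract m (index_enum_uniq _) f iE; rewrite -/P -e in ez' oz'.
have oQz : orthl Q z' by apply: orthl_supp oz'.
have cP : red P P by case: f => hc _; apply: hc.
have cQP : commute Q P.
  apply: (commute_root (hm i iE)); have -> : P ^+ m i = W * z'^-1 by rewrite ez' mulgK.
  apply: commuteM; first exact: commute_sym.
  by apply: commuteV; apply: orthl_comm.
(* The remainder [z'] of [W] is orthogonal to [Q], so [Q] is already a prefix of the part of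
   [W ^+ K] coming from [P]. *)
have hP : pre S Q (P ^+ (m i * K)).
  have om : orthl (P ^+ m i) z' by apply: orthl_supp oz' => // d; apply: supp_expg.
  apply: (@pre_orthl_mul _ _ (z' ^+ K)).
  - by rewrite expgnA; apply: orthl_supp om => d; apply: supp_expg.
  - by apply: orthl_supp oQz => // d; apply: supp_expg.
  by rewrite expgnA -expgMn -?ez' //; apply: orthl_comm.
have [_ prim_p _ _] := h; have [_ P1 iP npP] := (primitiveP cP).1 (prim_p i).
have [k ek] := commuting_prefix cP P1 iP npP hP cQP.
by exists i; apply: (@conjg_inj _ a); rewrite -/Q ek (npQ _ _ ek) expg1.
Qed.

(** The case [u = w] shows that two decompositions of an element have the same set of factors. *)
Lemma prim_decomp_le u w n (p : 'I_n -> G) m n' (p' : 'I_n' -> G) m' :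
  prim_decomp S u p m -> prim_decomp S w p' m' ->
  init_dominated u w -> range p `<=` range p'.
Proof.
move=> hu hw D _ [i _ <-]; have [_ pp _ _] := hu.
have [z c z1 ic|j ->] := dominated_factor (pp i) hw; last by exists j.
by apply: D => //; apply/(prim_decomp_init c z hu); exists i.
Qed.

Lemma PrimE w n (p : 'I_n -> G) m : prim_decomp S w p m -> Prim S w = range p.
Proof.
move=> h; apply/seteqP; split=> [q [n' [p' [m' [h' rq]]]]|q rq]; last by exists n, p, m.
by apply: prim_decomp_le h' h _ _ rq.
Qed.

Lemma Prim_init c w y : init c (w ^ y) <-> exists2 q, Prim S w q & init c (q ^ y).
Proof.
have [n [p [m h]]] := prim_decomp_ex w; rewrite (PrimE h) (prim_decomp_init c y h).
by split=> [[i ii]|[_ [i _ <-] ii]]; [exists (p i) => //; exists i|exists i].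
Qed.

Lemma dominated_Prim u w : init_dominated u w -> Prim S u `<=` Prim S w.
Proof.
have [n [p [m h]]] := prim_decomp_ex u; have [n' [p' [m' h']]] := prim_decomp_ex w.
by rewrite (PrimE h) (PrimE h'); apply: prim_decomp_le h h'.
Qed.

(** Neighbours suffice as test points: [z * c] precedes [z] for [w] exactly when [c] is not a first
    letter of [w ^ z]. *)
Lemma qprec_dominated w u : (forall x y, y != 1 -> qprec S w x y -> qprec S u x y) ->
  init_dominated u w.
Proof.
move=> h z c z1 iu; apply/negPn/negP => niw; have lc := letter_init iu.
have /(h _ _ z1) : qprec S w (z * c) z.
  apply/qprecP => d; rewrite mulKg => /init_supp; rewrite supp_letter // => /eqP<-.
  exact/negP.
move/qprecP => /(_ c); rewrite mulKg; apply => //.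
by have := @initV c 1 lc; rewrite init1 mulg1 => ->.
Qed.

Lemma quasidir_leP w u : quasidir_le S w u <-> Prim S u `<=` Prim S w.
Proof.
split=> [h|h x y /qprecP hxy]; first by apply/dominated_Prim/qprec_dominated => x y _; apply: h.
apply/qprecP => c ic /Prim_init[q /h qw iq]; apply: (hxy c ic).
by apply/Prim_init; exists q.
Qed.

(** * Quasidirections as operations, and the realization of admissible sets *)

Lemma qprec_refl w x : qprec S w x x. Proof. exact: segmentl. Qed.

(* At [y = 1] the default value of [quasidir] cannot be told from a genuine
   value, whence the side condition. *)
Lemma quasidirP w x y : y != 1 -> quasidir S w y x = y <-> qprec S w x y.
Proof.
move=> /eqP y1; split=> [|h].
  rewrite /quasidir; case: xgetP => [c _ [[_ _ hc] _] ec|_ e]; first by rewrite -ec.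
  by case: y1.
apply: xget_unique.
  split=> [|z _]; last exact: segmentl.
  by split; [exact: segmentl|exact: qprec_refl|].
move=> c [_ /(_ y)]; rewrite /segment /= mulVg => /(_ _)/pre_len.
rewrite wlen1 leqn0 wlen_eq0 mulg_eq1 => h'.
apply/esym/invg_inj/eqP/h'; split; [exact: segmentl|exact: qprec_refl|exact: h].
Qed.

Lemma quasidir_Prim w u : quasidir S w = quasidir S u -> Prim S w = Prim S u.
Proof.
move=> e; apply/seteqP; split; apply/dominated_Prim/qprec_dominated => x y y1.
  by rewrite -!quasidirP // e.
by rewrite -!quasidirP // e.
Qed.

Lemma Prim_quasidir w u : Prim S w = Prim S u -> quasidir S w = quasidir S u.
Proof.
have le v z : Prim S v = Prim S z -> quasidir_le S v z.
  by move=> e; apply/quasidir_leP; rewrite e.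
move=> e; suff eq : qprec S w = qprec S u by rewrite /quasidir /U_ eq.
apply/funext => x; apply/funext => y; apply/propext; split; first exact: le.
exact/le/esym.
Qed.

Lemma Prim_orth_prim_sets w : orth_prim_sets S (Prim S w).
Proof.
have [n [p [m h]]] := prim_decomp_ex w; rewrite (PrimE h).
have [a ca] := cr_ex w; have [hc ho] := prim_decomp_family h ca.
have Xa i : X_ S (p i) a by apply/X_P/hc; rewrite mem_index_enum.
split.
- exact/finite_image/finite_finset.
- by move=> _ [i _ <-]; case: h.
- by move=> _ _ [i _ <-] [j _ <-]; exists a.
move=> _ _ [i _ <-] [j _ <-] pij; exists a => //; apply/orthogonalP.
by apply: ho; rewrite ?mem_index_enum //; apply/eqP => ij; apply: pij; rewrite ij.
Qed.

Lemma orth_prim_sets_Prim F : orth_prim_sets S F -> exists w, Prim S w = F.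
Proof.
case=> /finite_seqP[s0 ->] hp _ ho; pose s := undup s0.
have sE x : (x \in s) = (x \in s0) by rewrite mem_undup.
have ho' x y : x \in s -> y \in s -> x != y ->
    exists b, [/\ red (x ^ b) (x ^ b), red (y ^ b) (y ^ b) & orthl (x ^ b) (y ^ b)].
  rewrite !sE => xs ys /eqP xy; have [b [/X_P bx /X_P by_] /orthogonalP o] := ho x y xs ys xy.
  by exists b.
have [|a ha] := @commuting_cr s.
  move=> x y xs ys; have [->//|xy] := eqVneq x y.
  have [b [_ _ /orthl_comm e]] := ho' x y xs ys xy.
  by apply: (@conjg_inj _ b); rewrite !conjMg.
(* Orthogonality is given at a point [b] that depends on the pair. Both elements are cyclically
   reduced at [a] and at [b], so their lengths agree there and orthogonality carries over. *)
have orth_a x y : x \in s -> y \in s -> x != y -> orthl (x ^ a) (y ^ a).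
  move=> xs ys xy; have [b [bx by_ o]] := ho' x y xs ys xy.
  pose P (i : bool) := if i then x ^ b else y ^ b.
  have fP : orth_family P [:: true; false].
    by split=> [[]//|[] [] // _ _ _]; rewrite /P // orthlC.
  have [|_ /(_ true false isT isT isT)] := @orth_family_conj _ _ _ (b^-1 * a) fP.
    by move=> [] _; rewrite /P cr_wlen // -conjgM mulVKg; apply: ha.
  by rewrite /P -!conjgM mulVKg.
(* Any positive exponents would do. As [s] has no duplicates, distinct indices give distinct
   elements. *)
pose p i := tnth (in_tuple s) i; pose w := \prod_(i < size s) p i ^+ 1.
have ps i : p i \in s by apply: mem_tnth.
have h : prim_decomp S w p (fun=> 1%N).
  apply: (@prim_decomp_intro _ _ _ _ a) => // [i|]; first by apply: hp => /=; rewrite -sE.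
  split=> [i _|i j _ _ ij]; first exact: ha.
  apply: orth_a => //; apply: contraNneq ij => /eqP.
  by rewrite /p !(tnth_nth 1) nth_uniq ?undup_uniq.
exists w; rewrite (PrimE h); apply/seteqP; split=> [_ [i _ <-]|x /=]; first by rewrite /= -sE.
by rewrite -sE => /(tnthP (in_tuple s))[i ->]; exists i.
Qed.

End RightAngledArtinGroup.

Theorem proposition8p16 (G : groupType) (S : set G) (hGS : is_raag S) :
  exists Phi : (G -> G -> G) -> set G,
    [/\ forall w : G, Phi (quasidir S w) = Prim S w,
        set_bij (range (quasidir S)) (orth_prim_sets S) Phi
      & forall w u : G, quasidir_le S w u <-> Prim S u `<=` Prim S w].
Proof.
(* The choice of a determining element does not matter, by [quasidir_Prim]; the default [set0]
   concerns only operations that are no quasidirections. *)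
pose Phi (f : G -> G -> G) : set G :=
  xget set0 [set F | exists2 w, f = quasidir S w & F = Prim S w].
have PhiE w : Phi (quasidir S w) = Prim S w.
  apply: xget_unique; first by exists w.
  by move=> F [u e ->]; apply/esym/(quasidir_Prim hGS).
exists Phi; split=> //; last exact: quasidir_leP.
split.
- by move=> _ [w _ <-]; rewrite PhiE; apply: Prim_orth_prim_sets.
- move=> f g /set_mem[w _ <-] /set_mem[u _ <-]; rewrite !PhiE.
  exact: Prim_quasidir.
- move=> F /(orth_prim_sets_Prim hGS)[w <-]; exists (quasidir S w); last exact: PhiE.
  by exists w.
Qed.
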